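(* Let $N\ge1$ be an integer. Fix $s_1\in(0,1)$, $p_1\in(1,\infty)$ such that $s_1p_1\ge1$, and $\theta\in(0,1)$. Let $0<s<1$ and $1<p<\infty$ be defined by $$s=\theta s_1+(1-\theta)\qquad\text{and}\qquad\frac1p=\frac{\theta}{p_1}+(1-\theta).$$ Let $1\le q\le\infty$. If there exists a constant $C$ such that $$\left[\frac{u(x)-u(y)}{|x-y|^{\frac{N}{p}+s}}\right]_{L^{p,q}(\mathbb{R}^N\times\mathbb{R}^N)}\le C\,|u|_{W^{s_1,p_1}(\mathbb{R}^N)}^{\theta}\,\|\nabla u\|_{L^1(\mathbb{R}^N)}^{1-\theta}\qquad\text{for all }u\in C_c^\infty(\mathbb{R}^N),$$ then $q\ge\frac{p_1}{\theta}$.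
   Context: $C_c^\infty(\mathbb{R}^N)$ is the space of real-valued smooth compactly supported functions on $\mathbb{R}^N$, and $\mathcal{L}^{2N}$ is Lebesgue measure on $\mathbb{R}^N\times\mathbb{R}^N$. For a measurable function $f$ on $\mathbb{R}^N\times\mathbb{R}^N$ and $1\le p<\infty$, the Lorentz quasi-norm is defined, when $1\le q<\infty$, by $$[f]_{L^{p,q}(\mathbb{R}^N\times\mathbb{R}^N)}^q=p\int_0^\infty\lambda^q\,\mathcal{L}^{2N}\bigl(\{(x,y)\in\mathbb{R}^N\times\mathbb{R}^N:\ |f(x,y)|\ge\lambda\}\bigr)^{\frac{q}{p}}\frac{d\lambda}{\lambda},$$ and, when $q=\infty$, by $$[f]_{L^{p,\infty}(\mathbb{R}^N\times\mathbb{R}^N)}^p=\sup_{\lambda>0}\lambda^p\,\mathcal{L}^{2N}\bigl(\{(x,y)\in\mathbb{R}^N\times\mathbb{R}^N:\ |f(x,y)|\ge\lambda\}\bigr).$$ For $0<\sigma<1$ and $1\le r<\infty$ the Gagliardo semi-norm is defined by $$|u|_{W^{\sigma,r}(\mathbb{R}^N)}^r=\iint_{\mathbb{R}^N\times\mathbb{R}^N}\frac{|u(x)-u(y)|^r}{|x-y|^{N+\sigma r}}\,dy\,dx.$$ The quotient in the claim is regarded as a function of $(x,y)$, defined for $x\ne y$. The constant $C$ does not depend on $u$. *)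

(* Defs.v *)
From HB Require Import structures.
From mathcomp Require Import all_boot all_order all_algebra.
From mathcomp Require Import all_classical all_reals all_analysis.

Set Implicit Arguments.
Unset Strict Implicit.
Unset Printing Implicit Defensive.

Import Order.TTheory GRing.Theory Num.Theory.
Import numFieldNormedType.Exports.

Local Open Scope classical_set_scope.
Local Open Scope ring_scope.

(* R^n is 'rV[R]_n. Its sigma-algebra is the product one, generated by the
   coordinate maps as for n.-tuple; it coincides with the Borel sigma-algebra
   of the topology of 'rV[R]_n. *)

Definition rV_display : measure_display.
Proof. exact: default_measure_display. Qed.

Section measurable_rV.
Variables (R : realType) (n : nat).

Definition rV_coord (i : 'I_n) (x : 'rV[R]_n) : measurableTypeR R := x ord0 i.

Let rV_set0 : g_sigma_preimage rV_coord set0.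
Proof. exact: sigma_algebra0. Qed.

Let rV_setC A : g_sigma_preimage rV_coord A -> g_sigma_preimage rV_coord (~` A).
Proof. exact: sigma_algebraC. Qed.

Let rV_bigcup (F : (set 'rV[R]_n)^nat) :
  (forall i, g_sigma_preimage rV_coord (F i)) ->
  g_sigma_preimage rV_coord (\bigcup_i (F i)).
Proof. exact: sigma_algebra_bigcup. Qed.

HB.instance Definition _ := @isMeasurable.Build rV_display 'rV[R]_n
  (g_sigma_preimage rV_coord) rV_set0 rV_setC rV_bigcup.

Lemma measurable_rV_coord i : measurable_fun [set: 'rV[R]_n] (rV_coord i).
Proof.
move=> _ Y mY; rewrite setTI; apply: sub_sigma_algebra => /=.
rewrite -bigcup_seq/=; exists i => /=; first by rewrite mem_index_enum.
by exists Y => //; rewrite setTI.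
Qed.

Lemma measurable_fun_rVP d (T : measurableType d) (f : T -> 'rV[R]_n) :
  (forall i, measurable_fun [set: T] (rV_coord i \o f)) ->
  measurable_fun [set: T] f.
Proof.
move=> mf.
suff prefS : g_sigma_preimage (fun i => rV_coord i \o f) `<=` measurable.
  rewrite g_sigma_preimage_comp in prefS.
  by move=> _ A mA; apply: prefS; exists A.
apply: smallest_sub; first exact: sigma_algebra_measurable.
by rewrite -bigcup_seq/= => A [i _ [B mB <-]]; exact: mf.
Qed.

End measurable_rV.

(* Lebesgue measure on R^n (Borel sets), as the n-fold product of the
   one-dimensional one: R^0 is a point of mass 1, and R^n.+1 is identified with
   R * R^n through rV_cons. See lebesgue_rV_box for its value on boxes. *)

Section rV_cons.
Variables (R : realType) (n : nat).
Local Notation Rm := (measurableTypeR R).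

Definition rV_cons (z : Rm * 'rV[R]_n) : 'rV[R]_n.+1 :=
  \row_i (if unlift ord0 i is Some j then z.2 ord0 j else z.1).

Definition rV_uncons (x : 'rV[R]_n.+1) : Rm * 'rV[R]_n :=
  (x ord0 ord0, \row_j x ord0 (lift ord0 j)).

Lemma rV_consK : cancel rV_cons rV_uncons.
Proof.
case=> a v; rewrite /rV_uncons /rV_cons !mxE unlift_none; congr pair.
by apply/rowP => j; rewrite !mxE liftK.
Qed.

Lemma measurable_rV_cons : measurable_fun [set: Rm * 'rV[R]_n] rV_cons.
Proof.
apply: measurable_fun_rVP => i; rewrite /rV_coord /rV_cons.
case: (unliftP ord0 i) => [j ->|->].
  rewrite (_ : _ \o _ = (rV_coord j : 'rV[R]_n -> Rm) \o snd); last first.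
    by apply/funext => z /=; rewrite !mxE liftK.
  by apply: measurableT_comp => //; exact: measurable_rV_coord.
rewrite (_ : _ \o _ = fst) //.
by apply/funext => z /=; rewrite !mxE unlift_none.
Qed.

Lemma measurable_rV_uncons : measurable_fun [set: 'rV[R]_n.+1] rV_uncons.
Proof.
apply: measurable_fun_pair; first exact: measurable_rV_coord.
apply: measurable_fun_rVP => i.
rewrite (_ : _ \o _ = rV_coord (lift ord0 i)); last first.
  by apply/funext => z /=; rewrite /rV_coord !mxE.
exact: measurable_rV_coord.
Qed.

Definition cons_measure (mu : {sigma_finite_measure set 'rV[R]_n -> \bar R})
  : set 'rV[R]_n.+1 -> \bar R :=
  pushforward (lebesgue_measure \x mu)%E rV_cons.

Variable mu : {sigma_finite_measure set 'rV[R]_n -> \bar R}.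

Let cons_measure0 : cons_measure mu set0 = 0%E.
Proof. by rewrite /cons_measure /pushforward preimage_set0 measure0. Qed.

Let cons_measure_ge0 A : (0 <= cons_measure mu A)%E.
Proof. by rewrite /cons_measure /pushforward. Qed.

Let cons_measure_sigma_additive : semi_sigma_additive (cons_measure mu).
Proof. by apply: measure_semi_sigma_additive; exact: measurable_rV_cons. Qed.

HB.instance Definition _ := isMeasure.Build _ _ _ (cons_measure mu)
  cons_measure0 cons_measure_ge0 cons_measure_sigma_additive.

Let cons_measure_sigma_finite : sigma_finite [set: 'rV[R]_n.+1] (cons_measure mu).
Proof.
have /sigma_finiteP[F [TF ndF Foo]] := sigma_finiteT (@lebesgue_measure R).
have /sigma_finiteP[G [TG ndG Goo]] := sigma_finiteT mu.
exists (fun k => rV_uncons @^-1` (F k `*` G k)).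
  rewrite -preimage_bigcup; apply/seteqP; split => // x _ /=.
  have [k _ Fk] : (\bigcup_k F k) (rV_uncons x).1 by rewrite -TF.
  have [l _ Gl] : (\bigcup_k G k) (rV_uncons x).2 by rewrite -TG.
  exists (maxn k l) => //; split.
    by apply: (subsetPset _ _ (ndF _ _ (leq_maxl k l))).
  by apply: (subsetPset _ _ (ndG _ _ (leq_maxr k l))).
move=> k; have [mFk Fk] := Foo k; have [mGk Gk] := Goo k.
have mFG : measurable (F k `*` G k) by exact: measurableX.
split.
  by rewrite -[X in measurable X]setTI; exact: measurable_rV_uncons.
rewrite /cons_measure /pushforward -comp_preimage (_ : _ \o _ = id); last first.
  by apply/funext => z; exact: rV_consK.
by rewrite product_measure1E// lte_mul_pinfty// ge0_fin_numE.
Qed.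

HB.instance Definition _ := Measure_isSigmaFinite.Build _ _ _ (cons_measure mu)
  cons_measure_sigma_finite.

End rV_cons.

Fixpoint lebesgue_rV (R : realType) (n : nat) :
    {sigma_finite_measure set 'rV[R]_n -> \bar R} :=
  if n is m.+1 then cons_measure (lebesgue_rV R m) else \d_(0 : 'rV[R]_0).

Lemma lebesgue_rV_box (R : realType) (n : nat) (A : 'I_n -> set R) :
  (forall i, measurable (A i : set (measurableTypeR R))) ->
  lebesgue_rV R n [set x | forall i, A i (x ord0 i)] =
  (\prod_(i < n) lebesgue_measure (A i))%E.
Proof.
elim: n A => [|n IH] A mA.
  rewrite big_ord0 /= diracE mem_set//=; by case.
rewrite big_ord_recl /= /cons_measure /pushforward.
rewrite (_ : _ @^-1` _ = A ord0 `*`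
   [set x : 'rV[R]_n | forall i, A (lift ord0 i) (x ord0 i)]).
  rewrite product_measure1E//; first by congr (_ * _)%E; exact: (IH (fun i => A (lift ord0 i))).
  rewrite (_ : [set _ | _] = \big[setI/setT]_(i < n)
     (rV_coord i @^-1` A (lift ord0 i))).
    apply: bigsetI_measurable => i _; rewrite -[X in measurable X]setTI.
    exact: measurable_rV_coord.
  rewrite -bigcap_seq; apply/seteqP; split => x /= h i; first by move=> _; exact: h.
  by apply: (h i) => /=; rewrite mem_index_enum.
apply/seteqP; split => -[a v] /=.
  move=> h; split; first by have := h ord0; rewrite mxE unlift_none.
  by move=> i; have := h (lift ord0 i); rewrite mxE liftK.
move=> [ha hv] i; rewrite mxE.
by case: (unliftP ord0 i) => [j ->|->].
Qed.

Section function_spaces.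
Variables (R : realType) (N : nat).
Local Notation Rn := 'rV[R]_N.
Implicit Types (u : Rn -> R) (x : Rn).

(* The library norm `|x| on 'rV[R]_N is the sup norm; this is the Euclidean
   one. *)
Definition enorm x : R := Num.sqrt (\sum_(i < N) x ord0 i ^+ 2).

Definition partial (i : 'I_N) u : Rn -> R := fun x => 'D_(delta_mx ord0 i) u x.

Fixpoint Ck (k : nat) u : Prop :=
  continuous u /\
  (if k is k'.+1 then
     (forall i x, derivable u x (delta_mx ord0 i)) /\
     (forall i, Ck k' (partial i u))
   else True).

Definition smooth u : Prop := forall k, Ck k u.

Definition Cc_infty : set (Rn -> R) :=
  [set u | smooth u /\ compact (closure [set x | u x != 0])].

Definition gradient u : Rn -> Rn := fun x => \row_i partial i u x.

End function_spaces.

Local Open Scope ereal_scope.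

(* The exponent q ranges over [1, +oo]; -oo gets a junk value. *)
Definition lorentz d (T : measurableType d) (R : realType)
    (mu : {measure set T -> \bar R}) (p : R) (q : \bar R) (f : T -> R) : \bar R :=
  match q with
  | q%:E =>
      (p%:E * \int[lebesgue_measure]_(l in `]0%R, +oo[)
         ((l `^ q)%:E * mu [set z | (l <= `|f z|)%R] `^ (q / p) * (l^-1)%:E))
      `^ q^-1
  | +oo =>
      (ereal_sup [set (l `^ p)%:E * mu [set z | (l <= `|f z|)%R]
                 | l in `]0%R, +oo[]) `^ p^-1
  | -oo => 0
  end.

Definition lebesgue_rV2 (R : realType) (N : nat) :
    {measure set ('rV[R]_N * 'rV[R]_N) -> \bar R} :=
  lebesgue_rV R N \x lebesgue_rV R N.

(* The integrand vanishes on the (negligible) diagonal, as 0 `^ a = 0 for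
   a != 0. *)
Definition gagliardo (R : realType) (N : nat) (sigma r : R)
    (u : 'rV[R]_N -> R) : \bar R :=
  (\int[lebesgue_rV2 R N]_z
     (`|u z.1 - u z.2| `^ r / enorm (z.1 - z.2) `^ (N%:R + sigma * r))%:E)
  `^ r^-1.

(* Off the diagonal this is (u x - u y) / |x - y|^a; on the (negligible)
   diagonal it is 0. *)
Definition diff_quotient (R : realType) (N : nat) (a : R) (u : 'rV[R]_N -> R)
    (z : 'rV[R]_N * 'rV[R]_N) : R :=
  ((u z.1 - u z.2) / enorm (z.1 - z.2) `^ a)%R.

(* Main.v *)
Require Import Defs.
From mathcomp Require Import all_boot all_order all_algebra.
From mathcomp Require Import all_classical all_reals all_analysis.
From mathcomp Require Import measurable_realfun.
From mathcomp Require Import ring lra.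

(* For the parameters below let G_J be the J-th smooth approximation of the
   Cantor function whose generation-j intervals have length rho^j and carry the
   increment w^j (when s1 p1 = 1 there is one interval per generation, w = 1, and
   G_J is a jump smoothed at scale rho^J). Tensoring bumps G_J(t+1) - G_J(t-1)
   gives u_J. If w^(p1-1) = rho^(s1 p1-1), which forces w^(p-1) = rho^(s p-1), then
   every scale rho^j with j <= J contributes the same amount to each side:
   - the total variation of u_J is bounded;
   - |u_J(x) - u_J(y)| is at most C w^j when |x - y| ~ rho^j, and the integral of
     |u_J(x) - u_J(y)| over |x - y| <= t is at most C t^(N+1), so that the p1-th
     power of the Gagliardo seminorm is at most K (J+1);
   - straddling the intervals of generation j produces pairs that contribute a
     constant to the Lorentz integral, which is therefore at least c J.
   Hence J^(1/q) <= B (J+1)^(theta/p1) for all J, that is 1/q <= theta/p1. *)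

Set Implicit Arguments.
Unset Strict Implicit.
Unset Printing Implicit Defensive.

Import Order.TTheory GRing.Theory Num.Theory.
Import numFieldNormedType.Exports.

Local Open Scope classical_set_scope.
Local Open Scope ring_scope.

(** There are [w ^- j] intervals of generation j, so [w] must be 1 or 1/2. For [s1 p1 > 1] and
    [w = 1/2], the balance relation gives [rho = 2^-t] with [t = (p1 - 1) / (s1 p1 - 1)], and
    [s1 < 1] makes [t > 1]: this is what leaves a gap between the two copies. The Gagliardo bound
    does not follow how increments are distributed. It writes |d|^p1 = |d|^(p1-1) |d| for a
    difference d, bounds the first factor by the modulus of continuity and the second in L^1 by the
    total variation. At distance rho^k this gives w^(k(p1-1)) rho^(-k(N + s1 p1)) rho^(k(N+1)) = 1.
    Shells finer than rho^J, where u_J is smooth, and shells at large distance decay geometrically.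
    On the Lorentz side, the levels l_j ~ w^j rho^(-j(N/p + s)) have superlevel sets of measure at
    least a constant times w^-j rho^(j(N+1)); the relation at (s, p) makes l_j^p times this measure
    constant. The l_j grow geometrically, hence occupy disjoint pieces of dl/l. Neighbourhoods of
    the diagonal are taken as products of strips, so that Tonelli reduces each integral to dimension
    one. *)

Section powers.
Variable R : realType.

Lemma powR_exprn (x y : R) k : 0 < x -> (x ^+ k) `^ y = x `^ (k%:R * y).
Proof. by move=> x0; rewrite -powR_mulrn ?ltW// powRrM. Qed.

Lemma powR_add (x : R) : 0 < x -> forall y z, x `^ y * x `^ z = x `^ (y + z).
Proof. by move=> x0 y z; rewrite powRD//; apply/implyP => _; rewrite gt_eqF. Qed.

Lemma powR_lt1 (x y : R) : 0 < x < 1 -> 0 < y -> 0 <= x `^ y < 1.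
Proof.
move=> /andP[x0 x1] y0; rewrite powR_ge0/= -[ltRHS](congr1 (@^~ y) (powR1 R)).
by rewrite gt0_ltr_powR// nnegrE ltW.
Qed.

End powers.

(** * A smooth monotone step on the line *)

Section smooth_functions.
Variable R : realType.
Implicit Types f g : R -> R.

(** Each derivative is an explicit witness rather than an iterated [derive1], so that the closure
    properties follow by induction from the usual formulas. *)
Fixpoint smooth_upto (k : nat) f : Prop :=
  if k is k'.+1 then
    exists f' : R -> R,
      (forall x, is_derive x (1 : R) f (f' x)) /\ smooth_upto k' f'
  else continuous f.

Lemma is_derive_continuous f (f' : R -> R) :
  (forall x, is_derive x (1 : R) f (f' x)) -> continuous f.
Proof.
move=> df x; apply: differentiable_continuous; apply/derivable1_diffP.
by case: (df x).
Qed.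

Lemma smooth_upto_continuous k f : smooth_upto k f -> continuous f.
Proof. by case: k => //= k [f' [df _]]; exact: is_derive_continuous df. Qed.

Lemma smooth_uptoW k f : smooth_upto k.+1 f -> smooth_upto k f.
Proof.
elim: k f => [f /smooth_upto_continuous //|k IH f] /= [f' [df sf]].
by exists f'; split => //; exact: IH.
Qed.

Lemma smooth_upto_cst k (c : R) : smooth_upto k (cst c).
Proof.
elim: k c => [c|k IH c] /=; first exact: cst_continuous.
by exists (cst 0); split=> [x|]; [exact: is_derive_cst|exact: IH].
Qed.

Lemma smooth_uptoD k f g :
  smooth_upto k f -> smooth_upto k g -> smooth_upto k (f \+ g).
Proof.
elim: k f g => [f g cf cg x|k IH f g] /=; first by apply: cvgD; [exact: cf|exact: cg].
move=> [f' [df sf]] [g' [dg sg]]; exists (f' \+ g'); split=> [x|]; last exact: IH.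
by have := df x; have := dg x => ? ?; exact: is_deriveD.
Qed.

Lemma smooth_uptoM k f g :
  smooth_upto k f -> smooth_upto k g -> smooth_upto k (f \* g).
Proof.
elim: k f g => [f g cf cg x|k IH f g]; first by apply: cvgM; [exact: cf|exact: cg].
move=> sf0 sg0; have := sf0; have := sg0.
move=> /= [g' [dg sg]] [f' [df sf]]; exists ((f' \* g) \+ (f \* g')); split=> [x|].
  have := df x; have := dg x => ? ?; apply: is_derive_eq.
  by rewrite /= /GRing.scale/=; ring.
by apply: smooth_uptoD; apply: IH => //; exact: smooth_uptoW.
Qed.

Lemma smooth_upto_affine k f (a b : R) :
  smooth_upto k f -> smooth_upto k (fun x => f (a * x + b)).
Proof.
elim: k f => [f cf x|k IH f] /=.
  apply: (@continuous_comp _ _ _ (fun x => a * x + b) f); last exact: cf.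
  by apply: cvgD; [apply: cvgM; [exact: cvg_cst|exact: cvg_id]|exact: cvg_cst].
move=> [f' [df sf]]; exists ((cst a) \* (fun x => f' (a * x + b))); split=> [x|]; last first.
  by apply: smooth_uptoM; [exact: smooth_upto_cst|exact: IH].
have da : is_derive x (1 : R) (fun x => a * x + b) a.
  have d1 := @is_deriveZ R R R id a x 1 1 (is_derive_id _ _).
  have := @is_deriveD R R R _ (cst b) x 1 _ _ d1 (is_derive_cst _ _ _).
  by rewrite addr0 /GRing.scale/= mulr1.
have := @is_derive1_comp R f (fun x => a * x + b) x _ _ (df _) da.
by rewrite mulrC.
Qed.

Lemma smooth_uptoZ k f (a : R) : smooth_upto k f -> smooth_upto k (fun x => a * f x).
Proof. by move=> sf; apply: (smooth_uptoM _ sf); exact: smooth_upto_cst. Qed.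

(** The derivative [- f' / f ^ 2] involves the inverse itself only to one order less, so the
    induction on [k] closes with [f] fixed. *)
Lemma smooth_uptoV k f : (forall x, f x != 0) ->
  smooth_upto k f -> smooth_upto k (fun x => (f x)^-1).
Proof.
move=> f0; elim: k => [cf x|k IH]; first by apply: cvgV; [exact: f0|exact: cf].
move=> sf0; have sf0' := smooth_uptoW sf0.
have [f' [df sf]] := sf0.
exists (fun x => -1 * (f' x * ((f x)^-1 * (f x)^-1))); split=> [x|].
  have := df x => -[dfx dfE].
  apply: DeriveDef; first exact: derivableV.
  rewrite deriveV// dfE /GRing.scale/= mulN1r mulNr; congr (- _).
  by rewrite mulrC -expr2 exprVn.
by apply: smooth_uptoZ; apply: smooth_uptoM => //; apply: smooth_uptoM; exact: IH.
Qed.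

(** The powers of [x^-1] are included because the span of this family is stable under
    differentiation, whereas [flat 0] alone is not. *)
Definition flat (n : nat) (x : R) : R :=
  if 0 < x then x^-1 ^+ n * expR (- x^-1) else 0.

Lemma flat_ge0 n x : 0 <= flat n x.
Proof.
rewrite /flat; case: ifPn => // x0; rewrite mulr_ge0 ?expR_ge0//.
by rewrite exprn_ge0// invr_ge0 ltW.
Qed.

(** With [p = n + m + 1], exp (1/x) is the [p]-th power of exp (1/(p x)), hence at least
    [(1/(p x)) ^ p]; this beats the factor [x^-1 ^+ n] and leaves [m + 1] powers of [x]. *)
Lemma flat_le n m x : 0 <= x -> flat n x <= (n + m).+1%:R ^+ (n + m).+1 * x ^+ m.+1.
Proof.
rewrite /flat le_eqVlt => /predU1P[<-|x0]; first by rewrite ltxx expr0n/= mulr0.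
rewrite x0; set p := (n + m).+1.
have p0 : (0 : R) < p%:R by rewrite ltr0n.
have h : (x^-1 / p%:R) ^+ p <= expR x^-1.
  rewrite -[leRHS](_ : expR (x^-1 / p%:R) ^+ p = _); last first.
    by rewrite -expRM_natl mulrC divfK// gt_eqF.
  apply: lerXn2r; rewrite ?nnegrE ?expR_ge0 ?divr_ge0 ?invr_ge0 ?(ltW x0) ?(ltW p0)//.
  by apply: le_trans (expR_ge1Dx _); rewrite lerDr.
have {}h : expR (- x^-1) <= p%:R ^+ p * x ^+ p.
  rewrite expRN -exprMn -[leRHS]invrK lef_pV2 ?posrE ?expR_gt0 ?invr_gt0 ?exprn_gt0 ?mulr_gt0//.
  by apply: le_trans h; rewrite -exprVn invfM [_^-1 * _^-1]mulrC.
apply: (@le_trans _ _ (x^-1 ^+ n * (p%:R ^+ p * x ^+ p))).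
  by apply: ler_wpM2l => //; rewrite exprn_ge0// invr_ge0 ltW.
rewrite mulrCA; apply: ler_wpM2l; first by rewrite exprn_ge0// ltW.
by rewrite /p -addnS exprD mulrA -exprMn mulVf ?gt_eqF// expr1n mul1r.
Qed.

Lemma is_derive_flat n x :
  is_derive x (1 : R) (flat n) (- n%:R * flat n.+1 x + flat n.+2 x).
Proof.
have [x0|x0|<-] := ltgtP 0 x.
- apply: (@near_eq_is_derive R R R (fun y => y^-1 ^+ n * expR (- y^-1))).
    near=> y; rewrite /flat ifT//; near: y; exact: lt_nbhsr.
  have dV : is_derive x (1 : R) (fun y : R => y^-1) (- x ^- 2).
    apply: DeriveDef; first by apply: derivableV; rewrite ?gt_eqF//; exact: derivable_id.
    by rewrite deriveV ?gt_eqF// derive_id /GRing.scale/= mulr1.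
  have dE : is_derive x (1 : R) (fun y : R => expR (- y^-1)) (x ^- 2 * expR (- x^-1)).
    have dN := @is_deriveN R R R _ x 1 _ dV.
    have := @is_derive1_comp R expR (fun y => - y^-1) x _ _ (is_derive_expR _) dN.
    by rewrite opprK mulrC.
  have dX := @is_deriveX R R _ n x 1 _ dV.
  have := @is_deriveM R R _ _ x 1 _ _ dX dE.
  set g := (X in is_derive _ _ X); set d := (X in is_derive _ _ _ X) => H.
  rewrite [X in is_derive _ _ X](_ : _ = g); last first.
    by apply/funext => y; rewrite /g/= fctE exprfctE.
  apply: is_derive_eq; rewrite /d /flat x0 /GRing.scale/= exprfctE.
  case: n {g d H dX} => [|n].
    by rewrite mulr0n -exprVn oppr0 !mul0r mulr0 addr0 add0r expr0 mul1r.
  rewrite -!exprVn !exprS expr0 /=; set E := expR _; set y := x^-1.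
  by rewrite -[in RHS]natr1 -mulr_natl -[in LHS]natr1 /=; ring.
- apply: (@near_eq_is_derive R R R (cst 0)).
    near=> y; rewrite /flat ifN//= -leNgt ltW//; near: y; exact: lt_nbhsl.
  by rewrite /flat !ifN -?leNgt ?ltW// mulr0 addr0; exact: is_derive_cst.
have flat0 m : flat m 0 = 0 by rewrite /flat ltxx.
rewrite !flat0 mulr0 addr0.
(* At 0 the slope function [flat n z / z] tends to 0, since [flat_le] with [m = 1] makes the
   numerator quadratic. Its value at 0 is 0 by the convention on inverses, as required for
   continuity. *)
apply/is_derive1_caratheodory; exists (fun z => flat n z / z).
split => [z||]; last by rewrite flat0 mul0r.
  rewrite flat0 !subr0; have [->|z0] := eqVneq z 0.
    by rewrite flat0 !mul0r.
  by rewrite divfK.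
rewrite /prop_for /continuous_at flat0 mul0r.
set c : R := (n + 1).+1%:R ^+ (n + 1).+1.
have cvg0 : c * `|z| @[z --> (0 : R)] --> (0 : R).
  have := cvgM (cvg_cst c) (@norm_continuous R R 0).
  by rewrite normr0 mulr0; exact.
apply: (@squeeze_cvgr _ _ _ _ (fun z => - (c * `|z|)) (fun z => c * `|z|)).
- near=> z; rewrite -ler_norml.
  have [z0|z0|<-] := ltgtP 0 z; last by rewrite flat0 mul0r !normr0 mulr0.
    rewrite normrM ger0_norm ?flat_ge0// normfV ler_pdivrMr ?normr_gt0 ?gt_eqF//.
    by have := flat_le n 1 (ltW z0); rewrite -mulrA -normrM -expr2 ger0_norm ?sqr_ge0.
  by rewrite /flat ltNge (ltW z0)/= mul0r normr0 mulr_ge0 ?exprn_ge0.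
- by have := cvgN cvg0; rewrite oppr0; exact.
- exact: cvg0.
Unshelve. all: by end_near. Qed.

Lemma smooth_upto_flat k n : smooth_upto k (flat n).
Proof.
elim: k n => [|k IH] n /=; first exact: is_derive_continuous (is_derive_flat n).
exists (fun x => - n%:R * flat n.+1 x + flat n.+2 x); split => [x|].
  exact: is_derive_flat.
by apply: smooth_uptoD (IH _); exact: smooth_uptoZ.
Qed.

Lemma flat_homo : {homo flat 0 : x y / x <= y}.
Proof.
move=> x y xy; rewrite /flat; case: ifPn => x0; last first.
  by case: ifPn => // _; rewrite expr0 mul1r expR_ge0.
rewrite (lt_le_trans x0 xy) !expr0 !mul1r ler_expR lerN2.
by rewrite lef_pV2 ?posrE// (lt_le_trans x0 xy).
Qed.

Definition smooth_step (x : R) : R := flat 0 x * (flat 0 x + flat 0 (1 - x))^-1.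

Lemma smooth_step_den x : 0 < flat 0 x + flat 0 (1 - x).
Proof.
have [x0|x0] := ltP 0 x.
  by rewrite ltr_pwDl ?flat_ge0// /flat x0 expr0 mul1r expR_gt0.
rewrite ltr_pwDr ?flat_ge0// /flat ifT ?expr0 ?mul1r ?expR_gt0//; lra.
Qed.

Lemma smooth_upto_step k : smooth_upto k smooth_step.
Proof.
apply: smooth_uptoM; first exact: smooth_upto_flat.
apply: smooth_uptoV => [x|]; first by rewrite gt_eqF// smooth_step_den.
apply: smooth_uptoD; first exact: smooth_upto_flat.
rewrite [X in smooth_upto _ X](_ : _ = fun x => flat 0 (-1 * x + 1)).
  exact: smooth_upto_affine (smooth_upto_flat k 0).
by apply/funext => x; rewrite mulN1r addrC.
Qed.

Lemma smooth_step0 x : x <= 0 -> smooth_step x = 0.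
Proof. by move=> x0; rewrite /smooth_step /flat ltNge x0 mul0r. Qed.

Lemma smooth_step1 x : 1 <= x -> smooth_step x = 1.
Proof.
move=> x1; have := smooth_step_den x; rewrite /smooth_step.
have -> : flat 0 (1 - x) = 0 by rewrite /flat ltNge subr_le0 x1.
rewrite addr0 => h.
by rewrite divff// gt_eqF.
Qed.

(** After cross-multiplication the common term cancels, leaving [flat 0 x * flat 0 (1 - y) <= flat 0
    y * flat 0 (1 - x)], which is monotonicity of [flat 0] twice. *)
Lemma smooth_step_homo : {homo smooth_step : x y / x <= y}.
Proof.
move=> x y xy; rewrite /smooth_step ler_pdivrMr ?smooth_step_den//.
rewrite mulrAC ler_pdivlMr ?smooth_step_den//.
have h1 := flat_homo xy; have h2 : flat 0 (1 - y) <= flat 0 (1 - x).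
  by apply: flat_homo; lra.
rewrite !mulrDr [flat 0 y * flat 0 x]mulrC lerD2l.
by apply: ler_pM; rewrite ?flat_ge0.
Qed.

End smooth_functions.

Lemma smooth_step_lipschitz (R : realType) :
  exists2 L : R, 0 < L & forall x y : R,
    `|smooth_step x - smooth_step y| <= L * `|x - y|.
Proof.
have [f' [df sf]] := @smooth_upto_step R 1.
have cf' : continuous f' by exact: sf.
have cs : continuous (@smooth_step R) by exact: smooth_upto_continuous (@smooth_upto_step R 0).
have [c c01 cM] : exists2 c : R, c \in `[0, 1]%R &
    forall t, t \in `[0, 1]%R -> `|f' t| <= `|f' c|.
  apply: (@EVT_max R (fun x => `|f' x|) 0 1) => //.
  apply: continuous_subspaceT => x; apply: continuous_comp; first exact: cf'.
  exact: norm_continuous.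
exists (`|f' c| + 1) => [|x y]; first by rewrite ltr_pwDr.
wlog xy : x y / x <= y.
  move=> H; have [xy|/ltW yx] := leP x y; first exact: H.
  by rewrite distrC [`|x - y|]distrC; exact: H.
have L0 : 0 <= `|f' c| + 1 by rewrite addr_ge0.
have [y0|y0] := leP y 0.
  by rewrite !smooth_step0// ?(le_trans xy)// subrr normr0 mulr_ge0.
have [x1|x1] := leP 1 x.
  by rewrite !smooth_step1// ?(le_trans _ xy)// subrr normr0 mulr_ge0.
(* Clamping both points to [[0, 1]] changes no value and does not increase their distance; the
   derivative is bounded there by compactness. *)
pose x' := Num.max x 0; pose y' := Num.min y 1.
have -> : smooth_step x = smooth_step x'.
  by rewrite /x'; have [x0|_] := leP x 0 => //; rewrite !smooth_step0.
have -> : smooth_step y = smooth_step y'.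
  by rewrite /y'; have [_|y1] := leP y 1 => //; rewrite !smooth_step1 ?lexx ?(ltW y1).
have xy' : x' <= y' by rewrite ge_max !le_min xy (ltW x1) (ltW y0) ler01.
have le0x' : 0 <= x' by rewrite le_max lexx orbT.
have ley'1 : y' <= 1 by rewrite ge_min lexx orbT.
rewrite distrC [`|x - y|]distrC.
have [//|d dxy ->] := @MVT_segment R (@smooth_step R) f' x' y' xy' (fun x _ => df x).
  exact: continuous_subspaceT.
rewrite normrM; apply: ler_pM => //.
  apply: (@le_trans _ _ `|f' c|); last by rewrite lerDl.
  apply: cM; move: dxy; rewrite !in_itv/= => /andP[h1 h2].
  by rewrite (le_trans le0x' h1) (le_trans h2 ley'1).
rewrite !ger0_norm ?subr_ge0//.
by apply: lerB; [rewrite ge_min lexx|rewrite le_max lexx].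
Qed.

(** * Smoothed Cantor functions: modulus of continuity and increments *)

Section cantor_function.
Variables (R : realType) (w rho : R).

(* For [w = 1/2] these are smoothed Cantor functions of contraction ratio
   [rho]; for [w = 1] they are smoothings of a single jump. *)
Fixpoint cantor_fun (J : nat) (x : R) : R :=
  if J is J'.+1 then
    w * cantor_fun J' (x / rho) + (1 - w) * cantor_fun J' ((x - (1 - rho)) / rho)
  else smooth_step x.

(* Left endpoints of the intervals of generation [j] (of length [rho ^+ j],
   each carrying the increment [w ^+ j]). *)
Fixpoint cantor_left (j : nat) : seq R :=
  if j is j'.+1 then
    map (fun a => rho * a) (cantor_left j') ++
    (if w == 1 then [::] else map (fun a => rho * a + (1 - rho)) (cantor_left j'))
  else [:: 0].

Hypothesis rho_bnd : 0 < rho < 2^-1.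
Hypothesis w_eq : w = 1 \/ w = 2^-1.

Let rho0 : 0 < rho. Proof. by case/andP : rho_bnd. Qed.
Let rho2 : rho < 2^-1. Proof. by case/andP : rho_bnd. Qed.
Let w2 : 2^-1 <= w. Proof. by case: w_eq => ->; lra. Qed.
Let w1 : w <= 1. Proof. by case: w_eq => ->; lra. Qed.
Let w0 : 0 < w. Proof. by apply: lt_le_trans w2. Qed.

Lemma smooth_upto_cantor k J : smooth_upto k (cantor_fun J).
Proof.
elim: J => [|J IH] /=; first exact: smooth_upto_step.
apply: smooth_uptoD; apply: smooth_uptoZ.
  rewrite [X in smooth_upto _ X](_ : _ = fun x => cantor_fun J (rho^-1 * x + 0)).
    exact: smooth_upto_affine.
  by apply/funext => x; rewrite addr0 mulrC.
rewrite [X in smooth_upto _ X]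
  (_ : _ = fun x => cantor_fun J (rho^-1 * x + (- (1 - rho) / rho))).
  exact: smooth_upto_affine.
by apply/funext => x; rewrite mulrBl mulNr mulrC.
Qed.

Lemma cantor_homo J : {homo cantor_fun J : x y / x <= y}.
Proof.
elim: J => [|J IH] x y xy /=; first exact: smooth_step_homo.
apply: lerD; (apply: ler_wpM2l; [by rewrite ?subr_ge0// ltW|apply: IH]);
  by rewrite ler_pM2r ?invr_gt0// ?lerD2r.
Qed.

Lemma cantor0 J x : x <= 0 -> cantor_fun J x = 0.
Proof.
elim: J x => [|J IH] x x0 /=; first exact: smooth_step0.
rewrite !IH ?mulr0 ?addr0// pmulr_lle0 ?invr_gt0//.
by have := rho2; move: x0; lra.
Qed.

Lemma cantor1 J x : 1 <= x -> cantor_fun J x = 1.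
Proof.
elim: J x => [|J IH] x x1 /=; first exact: smooth_step1.
rewrite !IH ?ler_pdivlMr ?mul1r//; first by rewrite !mulr1 addrC subrK.
  by rewrite lerBrDr addrC subrK.
by have := rho2; move: x1; lra.
Qed.

Lemma cantor_bnd J x : 0 <= cantor_fun J x <= 1.
Proof.
apply/andP; split.
  have [x0|x0] := leP x 0; first by rewrite cantor0.
  by rewrite -(cantor0 J (lexx (0 : R))) cantor_homo// ltW.
have [x1|x1] := leP 1 x; first by rewrite cantor1.
by rewrite -(cantor1 J (lexx (1 : R))) cantor_homo// ltW.
Qed.

Lemma cantor_dist_le1 J x y : `|cantor_fun J x - cantor_fun J y| <= 1.
Proof. have := cantor_bnd J x; have := cantor_bnd J y; rewrite ler_norml; lra. Qed.

(* Points at distance less than the gap [1 - 2 * rho] do not straddle both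
   copies of the previous generation, so that only one term varies. *)
Lemma cantor_dist_rec J (x y B : R) : `|x - y| <= 1 - 2 * rho ->
  (forall x' y', `|x' - y'| <= `|x - y| / rho ->
    `|cantor_fun J x' - cantor_fun J y'| <= B) ->
  `|cantor_fun J.+1 x - cantor_fun J.+1 y| <= w * B.
Proof.
wlog xy : x y / x <= y.
  move=> H; have [xy|/ltW yx] := leP x y; first exact: H.
  move=> h HB; rewrite distrC; by apply: H => //; rewrite distrC.
move=> h HB; have B0 : 0 <= B.
  apply: le_trans (HB x x _); first by rewrite normr_ge0.
  by rewrite subrr normr0 divr_ge0// ltW.
have dist_scale c : `|(x - c) / rho - (y - c) / rho| <= `|x - y| / rho.
  rewrite -mulrBl normrM [`|rho^-1|]gtr0_norm ?invr_gt0//.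
  by rewrite opprB addrA subrK.
have {}h : y - x <= 1 - 2 * rho by move: h; rewrite distrC ger0_norm ?subr_ge0.
(* If [x < rho] then [y < 1 - rho], and the second copy is 0 at both points. Otherwise the first
   copy is 1 at both, and the other one has weight [1 - w <= w]. *)
rewrite /=; have [xr|xr] := ltP x rho.
  rewrite [cantor_fun J ((x - _) / _)]cantor0; last first.
    by rewrite pmulr_lle0 ?invr_gt0//; move: rho2 xr; lra.
  rewrite [cantor_fun J ((y - _) / _)]cantor0; last first.
    by rewrite pmulr_lle0 ?invr_gt0//; move: rho2 xr h; lra.
  rewrite mulr0 !addr0 -mulrBr normrM ger0_norm ?(ltW w0)// ler_wpM2l ?(ltW w0)//.
  by apply: HB; have := dist_scale 0; rewrite !subr0.
rewrite [cantor_fun J (x / rho)]cantor1 ?ler_pdivlMr ?mul1r//.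
rewrite [cantor_fun J (y / rho)]cantor1 ?ler_pdivlMr ?mul1r ?(le_trans xr)//.
have -> (a b : R) : w * 1 + (1 - w) * a - (w * 1 + (1 - w) * b) = (1 - w) * (a - b).
  by ring.
rewrite normrM ger0_norm ?subr_ge0//.
apply: ler_pM => //; rewrite ?subr_ge0//; first by move: w2; lra.
exact: HB.
Qed.

(** Applying [cantor_dist_rec] [k] times divides the distance by [rho] and gains a factor [w] each
    time, ending with the trivial bound 1. It is Hölder continuity of exponent log w / log rho down
    to the scale [rho ^+ J]. *)
Lemma cantor_holder J k x y : (k <= J)%N -> `|x - y| <= (1 - 2 * rho) * rho ^+ k ->
  `|cantor_fun J x - cantor_fun J y| <= w ^+ k.
Proof.
have g0 : 0 <= 1 - 2 * rho by move: rho2; lra.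
elim: J k x y => [|J IH] [|k] x y // kJ h; try by rewrite expr0 cantor_dist_le1.
rewrite exprS; apply: cantor_dist_rec.
  apply: (le_trans h); rewrite ler_piMr// exprn_ile1 ?ltW//.
  by move: rho2; lra.
move=> x' y' h'; apply: IH => //; apply: (le_trans h').
by rewrite ler_pdivrMr// -mulrA -exprSr.
Qed.

(** Complements [cantor_holder] below the scale [rho ^+ J]: a copy is compressed by [rho] and scaled
    by at most [w], so a generation multiplies the slope by [w / rho >= 1]. Beyond the gap the
    trivial bound 1 suffices, which accounts for the second summand of [L]. *)
Lemma cantor_lipschitz : exists2 L : R, 0 < L & forall J x y,
  `|cantor_fun J x - cantor_fun J y| <= L * (w / rho) ^+ J * `|x - y|.
Proof.
have [L0 L00 HL] := @smooth_step_lipschitz R.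
have g0 : 0 < 1 - 2 * rho by move: rho2; lra.
pose L := L0 + (1 - 2 * rho)^-1.
have Lpos : 0 < L by rewrite addr_gt0 ?invr_gt0.
exists L => // J.
elim: J => [|J IH] x y.
  rewrite expr0 mulr1; apply: le_trans (HL _ _) _.
  by rewrite ler_wpM2r// lerDl invr_ge0 ltW.
have wr : 1 <= w / rho by rewrite ler_pdivlMr// mul1r; move: rho2 w2; lra.
have [h|h] := leP `|x - y| (1 - 2 * rho).
  rewrite (_ : L * _ * _ = w * (L * (w / rho) ^+ J * (`|x - y| / rho))); last first.
    by rewrite exprS; ring.
  apply: cantor_dist_rec => // x' y' h'; apply: le_trans (IH _ _) _.
  apply: ler_wpM2l => //; apply: mulr_ge0; first exact: ltW.
  by apply: exprn_ge0; exact: le_trans wr.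
apply: le_trans (cantor_dist_le1 _ _ _) _.
apply: (@le_trans _ _ ((1 - 2 * rho)^-1 * 1 * `|x - y|)).
  by rewrite mulr1 ler_pdivlMl// mulr1 ltW.
apply: ler_wpM2r => //; apply: ler_pM; rewrite ?invr_ge0 ?(ltW g0)//.
  by rewrite lerDr ltW.
exact: exprn_ege1.
Qed.

Lemma cantor_left_bnd j a : a \in cantor_left j -> 0 <= a <= 1 - rho ^+ j.
Proof.
elim: j a => [|j IH] a; first by rewrite inE => /eqP ->; rewrite expr0 subrr lexx.
rewrite /= mem_cat => /orP[/mapP[b /IH hb ->]|].
  have h1 : rho * b <= rho * (1 - rho ^+ j) by rewrite ler_pM2l//; case/andP : hb.
  rewrite mulr_ge0 ?(ltW rho0)//=; last by case/andP : hb.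
  by rewrite exprS; move: h1 rho2; rewrite mulrBr mulr1; lra.
case: ifPn => // _ /mapP[b /IH hb ->].
have h1 : rho * b <= rho * (1 - rho ^+ j) by rewrite ler_pM2l//; case/andP : hb.
have h2 : 0 <= rho * b by rewrite mulr_ge0 ?(ltW rho0)//=; case/andP : hb.
by rewrite exprS; move: h1 h2 rho2; rewrite mulrBr mulr1; lra.
Qed.

(** The recursion lists endpoints in increasing order: intervals of the first copy end before [rho],
    those of the second start after [1 - rho]. This ordered form yields disjointness of the strips
    used for the Lorentz bound. *)
Lemma cantor_left_sep j :
  pairwise (fun a b => a + rho ^+ j <= b) (cantor_left j).
Proof.
elim: j => [//|j IH] /=; rewrite pairwise_cat.
apply/and3P; split.
- apply/allrelP => a b /mapP[c /cantor_left_bnd hc ->].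
  case: ifPn => // _ /mapP[d /cantor_left_bnd hd ->].
  have : rho * c <= rho * (1 - rho ^+ j) by rewrite ler_pM2l//; case/andP : hc.
  have : 0 <= rho * d by rewrite mulr_ge0 ?(ltW rho0)//=; case/andP : hd.
  by rewrite exprS mulrBr mulr1; move: rho2; lra.
- rewrite pairwise_map; apply: sub_pairwise IH => a b /= ab.
  by rewrite exprS -mulrDr ler_pM2l.
case: ifPn => // _; rewrite pairwise_map; apply: sub_pairwise IH => a b /= ab.
by rewrite exprS addrAC -mulrDr lerD2r ler_pM2l.
Qed.

(** By self-similarity: on the interval of one copy the other copy is constant, so increments are
    scaled by the weight of the copy alone. *)
Lemma cantor_left_incr j J a : (j <= J)%N -> a \in cantor_left j ->
  cantor_fun J a + w ^+ j <= cantor_fun J (a + rho ^+ j).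
Proof.
elim: j J a => [|j IH] J a jJ.
  rewrite inE => /eqP ->; rewrite !expr0 add0r [leRHS]cantor1//.
  by rewrite [X in X + _]cantor0// add0r.
case: J jJ => // J jJ.
have copy1 c : c <= 1 -> cantor_fun J.+1 (rho * c) = w * cantor_fun J c.
  move=> c1 /=; rewrite [rho * c / rho]mulrC mulKf ?gt_eqF//.
  rewrite [X in _ + _ * X]cantor0 ?mulr0 ?addr0// pmulr_lle0 ?invr_gt0//.
  have : rho * c <= rho by rewrite ler_piMr// ltW.
  by move: rho2; lra.
have copy2 c : 0 <= c ->
    cantor_fun J.+1 (rho * c + (1 - rho)) = w + (1 - w) * cantor_fun J c.
  move=> c0 /=; rewrite addrK [rho * c / rho]mulrC mulKf ?gt_eqF//.
  rewrite [X in _ * X + _]cantor1 ?mulr1// ler_pdivlMr// mul1r.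
  have : 0 <= rho * c by rewrite mulr_ge0// ltW.
  by move: rho2; lra.
have rj : 0 <= rho ^+ j by rewrite exprn_ge0// ltW.
rewrite [cantor_left _]/= mem_cat => /orP[/mapP[b hb ->]|].
  have /andP[b0 b1] := cantor_left_bnd hb.
  rewrite [in leRHS]exprS -mulrDr !copy1; [|lra..].
  by rewrite exprS -mulrDr ler_pM2l//; exact: IH.
case: ifPn => // wn1 /mapP[b hb ->].
(* Second-copy endpoints are listed only when [w] is 1/2, and then the weight [1 - w] is [w]
   again. *)
have ww : w = 2^-1 by case: w_eq => // w_1; rewrite w_1 eqxx in wn1.
have /andP[b0 b1] := cantor_left_bnd hb.
rewrite [in leRHS]exprS [in leRHS]addrAC -mulrDr !copy2; [|lra..].
have -> : 1 - w = w by rewrite ww; lra.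
rewrite -addrA lerD2l exprS -mulrDr ler_pM2l//; exact: IH.
Qed.

(** Turns the number of straddled intervals into the factor [w ^- j] of the measure of a superlevel
    set. *)
Lemma cantor_left_size j : (size (cantor_left j))%:R * w ^+ j = 1.
Proof.
elim: j => [|j IH] /=; first by rewrite expr0 mulr1.
rewrite size_cat size_map natrD exprS mulrDl.
case: w_eq => ww; last first.
  rewrite ifN; last by rewrite ww lt_eqF//; lra.
  by rewrite size_map mulrCA IH ww; lra.
by rewrite ww eqxx mul0r addr0 mul1r; move: IH; rewrite ww.
Qed.

End cantor_function.

(** * Tonelli for integrands that are products over the coordinates *)

Section product_integrals.
Variable R : realType.
Local Open Scope ereal_scope.
Local Notation Rm := (measurableTypeR R).
Local Notation mu := (@lebesgue_measure R).

Lemma emeasurable_prod d (T : measurableType d) (D : set T) (I : Type)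
    (s : seq I) (h : I -> T -> \bar R) :
  (forall i, measurable_fun D (h i)) ->
  measurable_fun D (fun x => \prod_(i <- s) h i x).
Proof.
move=> mh; elim: s => [|i s IH].
  by under eq_fun do rewrite big_nil; exact: measurable_cst.
by under eq_fun do rewrite big_cons; exact: emeasurable_funM.
Qed.

Lemma measurable_rV_coord_comp d (T : measurableType d) n (i : 'I_n) (f : Rm -> T) :
  measurable_fun [set: Rm] f ->
  measurable_fun [set: 'rV[R]_n] (fun x => f (x ord0 i)).
Proof. by move=> mf; apply: (measurableT_comp mf); exact: measurable_rV_coord. Qed.

(** Lebesgue measure in dimension [n.+1] is by construction the image of a product measure under
    [rV_cons], so Tonelli splits off the first coordinate. *)
Lemma integral_rV_prod n (f : 'I_n -> Rm -> \bar R) :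
  (forall i, measurable_fun [set: Rm] (f i)) ->
  (forall i t, 0 <= f i t) ->
  \int[lebesgue_rV R n]_x \prod_(i < n) f i (x ord0 i) =
  \prod_(i < n) \int[mu]_t f i t.
Proof.
elim: n f => [|n IH] f mf f0.
  rewrite big_ord0 /= integral_dirac//; last first.
    by under eq_fun do rewrite big_ord0; exact: measurable_cst.
  by rewrite big_ord0 diracT mule1.
have mF m (g : 'I_m -> Rm -> \bar R) : (forall i, measurable_fun [set: Rm] (g i)) ->
    measurable_fun [set: 'rV[R]_m] (fun x => \prod_(i < m) g i (x ord0 i)).
  by move=> mg; apply: emeasurable_prod => i; exact: measurable_rV_coord_comp.
rewrite /= (@ge0_integral_pushforward _ _ _ _ _ _ (@measurable_rV_cons R n)
  (mu \x lebesgue_rV R n) setT); [|by []|exact: mF|by move=> x _; apply: prode_ge0].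
rewrite preimage_setT.
pose g (z : Rm * 'rV[R]_n) := f ord0 z.1 * \prod_(i < n) f (lift ord0 i) (z.2 ord0 i).
rewrite (eq_integral g); last first.
  move=> z _; rewrite /g/= big_ord_recl mxE unlift_none; congr (_ * _).
  by apply: eq_bigr => i _; rewrite mxE liftK.
rewrite fubini_tonelli1; last 2 first.
- apply: emeasurable_funM; first exact: (measurableT_comp (mf ord0)).
  by apply: (measurableT_comp (mF n (fun i => f (lift ord0 i)) _) measurable_snd).
- by move=> z; rewrite mule_ge0// prode_ge0.
rewrite big_ord_recl -(IH (fun i => f (lift ord0 i)))//.
pose K := \int[lebesgue_rV R n]_x \prod_(i < n) f (lift ord0 i) (x ord0 i).
have K0 : 0 <= K by apply: integral_ge0 => x _; exact: prode_ge0.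
under eq_integral => x _.
  rewrite /fubini_F /g/= ge0_integralZl//; last 2 first.
    exact: (mF n (fun i => f (lift ord0 i))).
    by move=> y _; exact: prode_ge0.
  rewrite -/K muleC.
  over.
by rewrite ge0_integralZl// muleC.
Qed.

(** A kernel that couples the [i]-th coordinate of one point only with the [i]-th coordinate of the
    other factors completely: [integral_rV_prod] is applied in [y] for fixed [x], then in [x]. *)
Lemma integral_rV2_prod n (F : 'I_n -> Rm * Rm -> \bar R) :
  (forall i, measurable_fun [set: Rm * Rm] (F i)) ->
  (forall i z, 0 <= F i z) ->
  \int[lebesgue_rV2 R n]_z \prod_(i < n) F i (z.1 ord0 i, z.2 ord0 i) =
  \prod_(i < n) \int[mu]_x \int[mu]_y F i (x, y).
Proof.
move=> mF F0; rewrite /lebesgue_rV2 fubini_tonelli1; last 2 first.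
- apply: emeasurable_prod => i.
  apply: (measurableT_comp (mF i)); apply: measurable_fun_pair.
    exact: (measurableT_comp (@measurable_rV_coord R n i) measurable_fst).
  exact: (measurableT_comp (@measurable_rV_coord R n i) measurable_snd).
- by move=> z; exact: prode_ge0.
under eq_integral => x _.
  rewrite /fubini_F /= (integral_rV_prod (f := fun i t => F i (x ord0 i, t)))//.
    over.
  by move=> i; apply: (measurableT_comp (mF i)).
rewrite (integral_rV_prod (f := fun i t => \int[mu]_y F i (t, y)))//.
- by move=> i; exact: (measurable_fun_fubini_tonelli_F (F i)).
- by move=> i t; exact: integral_ge0.
Qed.

End product_integrals.

(** * Derivatives and strips around the diagonal in dimension one *)

Section one_dimensional_estimates.
Variable R : realType.
Local Notation mu := (@lebesgue_measure R).

Lemma smooth_upto_derive1 k (f : R -> R) : smooth_upto k.+1 f ->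
  (forall x, is_derive x (1 : R) f (derive1 f x)) /\ smooth_upto k (derive1 f : R -> R).
Proof.
move=> [f' [df sf]]; have -> : derive1 f = f'.
  by apply/funext => x; rewrite derive1E; case: (df x).
by split.
Qed.

(** Adding [e * y] makes the function strictly increasing, so [d + e] is nonnegative for every
    [e > 0]. *)
Lemma homo_derive_ge0 (f : R -> R) x (d : R) :
  (forall x, derivable f x 1) -> {homo f : x y / x <= y} ->
  is_derive x (1 : R) f d -> 0 <= d.
Proof.
move=> df hf dx; apply/ler_addgt0Pl => e e0.
pose g (y : R) := f y + e * y.
have dg y : is_derive y (1 : R) g (derive1 f y + e).
  have d1 := @is_deriveZ R R R id e y 1 1 (is_derive_id _ _).
  have d2 : is_derive y (1 : R) f (derive1 f y) by rewrite derive1E; exact: derivableP.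
  have := @is_deriveD R R R f _ y 1 _ _ d2 d1.
  by rewrite /GRing.scale/= mulr1.
have := @incr_derive1_ge0 R g setT x.
rewrite derive1E (_ : 'D_1 g x = derive1 f x + e); last by case: (dg x).
rewrite derive1E (_ : 'D_1 f x = d); last by case: dx.
rewrite addrC; apply.
- by move=> y _; case: (dg y).
- by move=> y z _ _ yz; rewrite /g ler_ltD ?hf ?ltW// ltr_pM2l.
- by rewrite interiorT.
Qed.

Lemma continuous_derivable_FTC2 (f f' : R -> R) a b : a < b ->
  (forall x, is_derive x (1 : R) f (f' x)) -> continuous f' ->
  (\int[mu]_(x in `[a, b]) (f' x)%:E = (f b - f a)%:E)%E.
Proof.
move=> ab df cf'; have cf := is_derive_continuous df.
rewrite (@continuous_FTC2 _ f' f)//.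
- exact: continuous_subspaceT.
- split; first by move=> x _; case: (df x).
  + exact/cvg_at_right_filter/cf.
  + exact/cvg_at_left_filter/cf.
- by move=> x _; rewrite derive1E; case: (df x).
Qed.

Lemma integral_derive_transition (f f' : R -> R) a b : a < b ->
  (forall x, is_derive x (1 : R) f (f' x)) -> continuous f' ->
  {homo f : x y / x <= y} ->
  (forall x, x <= a -> f x = 0) -> (forall x, b <= x -> f x = 1) ->
  (\int[mu]_x (f' x)%:E = 1)%E.
Proof.
move=> ab df cf' hf fa fb.
have f'out x : (x < a) || (b < x) -> f' x = 0.
  case/orP => h; have [_ <-] := df x.
    rewrite (@near_eq_derive R R R f (cst 0))// ?derive_cst//.
    by near=> y; rewrite fa// ltW//; near: y; exact: lt_nbhsl.
  rewrite (@near_eq_derive R R R f (cst 1))// ?derive_cst//.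
  by near=> y; rewrite fb// ltW//; near: y; exact: lt_nbhsr.
transitivity (\int[mu]_(x in `[a, b]) (f' x)%:E)%E.
  rewrite [RHS]integral_mkcond; apply: eq_integral => x _.
  rewrite patchE; case: ifPn => // /negP; rewrite inE/= in_itv/= => /negP.
  by rewrite negb_and -!ltNge => /f'out ->.
by rewrite (continuous_derivable_FTC2 _ df)// fb// fa// subr0.
Unshelve. all: by end_near. Qed.

Definition band (t : R) : set (R * R) := [set z | `|z.1 - z.2| <= t].

Lemma measurable_band t : measurable (band t).
Proof.
rewrite /band -[X in measurable X]setTI.
apply: (@measurable_fun_le _ _ R setT (fun z : R * R => `|z.1 - z.2|) (cst t)) => //.
apply: measurableT_comp => //; exact: measurable_funB.
Qed.

Lemma band_sym t x y : \1_(band t) (x, y) = \1_(band t) (y, x) :> R.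
Proof.
rewrite !indicE (_ : (x, y) \in band t = ((y, x) \in band t))//.
by apply/idP/idP; rewrite !inE /band/= distrC.
Qed.

Local Open Scope ereal_scope.

Lemma integral_band t x : (0 <= t)%R ->
  \int[mu]_y (\1_(band t) (x, y))%:E = (2 * t)%:E.
Proof.
move=> t0.
under eq_integral => y _.
  rewrite (_ : \1_(band t) (x, y) = \1_(`[(x - t)%R, (x + t)%R]%classic) y); last first.
    rewrite !indicE; congr ((nat_of_bool _)%:R).
    apply/idP/idP; rewrite !inE/= /band/= in_itv/=;
      by rewrite ler_norml; move=> /andP[? ?]; apply/andP; split; lra.
  over.
rewrite integral_indic// setIT.
apply: (etrans (@lebesgue_measure_itv R `[(x - t)%R, (x + t)%R])).
rewrite /= lte_fin.
case: ltP => h; first by rewrite -EFinD; congr (_%:E); lra.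
by congr (_%:E); move: h t0; lra.
Qed.

Lemma measurable_indic_band t :
  measurable_fun [set: R * R] (fun z => (\1_(band t) z)%:E : \bar R).
Proof. by apply/measurable_EFinP; exact: measurable_indic (measurable_band t). Qed.

Lemma integral_bandl t (h : R -> \bar R) : (0 <= t)%R -> measurable_fun setT h ->
  (forall x, 0 <= h x) ->
  \int[mu]_x \int[mu]_y ((\1_(band t) (x, y))%:E * h x) = (2 * t)%:E * \int[mu]_x h x.
Proof.
move=> t0 mh h0.
under eq_integral => x _.
  under eq_integral do rewrite muleC.
  rewrite ge0_integralZl//; last first.
    exact: (measurableT_comp (measurable_indic_band t) (pair1_measurable x)).
  rewrite integral_band// muleC.
  over.
by rewrite ge0_integralZl// lee_fin mulr_ge0.
Qed.

Lemma integral_bandr t (h : R -> \bar R) : (0 <= t)%R -> measurable_fun setT h ->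
  (forall x, 0 <= h x) ->
  \int[mu]_x \int[mu]_y ((\1_(band t) (x, y))%:E * h y) = (2 * t)%:E * \int[mu]_x h x.
Proof.
move=> t0 mh h0.
rewrite -(integral_bandl t0 mh h0).
apply: (etrans (fubini_tonelli (m1 := mu) (m2 := mu)
  (fun z => (\1_(band t) z)%:E * h z.2) _ _)).
- apply: emeasurable_funM; last exact: (measurableT_comp mh measurable_snd).
  exact: measurable_indic_band.
- by move=> z; rewrite mule_ge0// lee_fin.
- by apply: eq_integral => y _; apply: eq_integral => x _; rewrite band_sym.
Qed.

Lemma measurable_integral2 (F : R * R -> \bar R) :
  measurable_fun [set: R * R] F -> (forall z, 0 <= F z) ->
  measurable_fun [set: R] (fun x => \int[mu]_y F (x, y)).
Proof. exact: (@measurable_fun_fubini_tonelli_F _ _ _ _ R mu F). Qed.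

Lemma ge0_le_integral2 (F G : R * R -> \bar R) :
  measurable_fun [set: R * R] F -> measurable_fun [set: R * R] G ->
  (forall z, 0 <= F z) -> (forall z, F z <= G z) ->
  \int[mu]_x \int[mu]_y F (x, y) <= \int[mu]_x \int[mu]_y G (x, y).
Proof.
move=> mF mG F0 FG; have G0 z : 0 <= G z by exact: le_trans (F0 z) (FG z).
apply: ge0_le_integral => //.
- by move=> x _; apply: integral_ge0.
- exact: measurable_integral2.
- exact: measurable_integral2.
move=> x _; apply: ge0_le_integral => //.
- exact: (measurableT_comp mF (pair1_measurable x)).
- exact: (measurableT_comp mG (pair1_measurable x)).
Qed.

(** For [|x - y| <= t], every [z] between [x] and [y] is within [t] of [x], so [|f x - f y|] is at
    most the integral [H x] of [|f'|] over the strip. Integrating in [y] and exchanging [x] with [z]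
    each give a factor [2 * t]. *)
Lemma integral_band_dist t (f f' : R -> R) : (0 <= t)%R ->
  (forall x, is_derive x (1%R : R) f (f' x)) -> continuous f' ->
  \int[mu]_x \int[mu]_y ((\1_(band t) (x, y))%:E * `|f x - f y|%:E) <=
  (4 * t ^+ 2)%:E * \int[mu]_x `|f' x|%:E.
Proof.
move=> t0 df cf'.
have mf' : measurable_fun [set: R] (fun x => `|f' x|%:E).
  by apply/measurable_EFinP; apply: measurableT_comp => //; exact: continuous_measurable_fun.
have mf : measurable_fun [set: R] f.
  by apply: continuous_measurable_fun; exact: is_derive_continuous df.
have mb := measurable_indic_band t.
pose H (x : R) := \int[mu]_z ((\1_(band t) (x, z))%:E * `|f' z|%:E).
have mbf' : measurable_fun [set: R * R] (fun z => (\1_(band t) z)%:E * `|f' z.2|%:E).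
  by apply: emeasurable_funM => //; exact: (measurableT_comp mf' measurable_snd).
have mH : measurable_fun [set: R] H.
  by apply: (measurable_integral2 mbf') => z; rewrite mule_ge0// lee_fin.
have H0 x : 0 <= H x by apply: integral_ge0 => z _; rewrite mule_ge0// lee_fin.
apply: (@le_trans _ _ (\int[mu]_x \int[mu]_y ((\1_(band t) (x, y))%:E * H x))); last first.
  rewrite integral_bandl// /H integral_bandr// muleA -EFinM.
  by rewrite (_ : 2 * t * (2 * t) = 4 * t ^+ 2)%R//; ring.
have m1 : measurable_fun [set: R * R]
    (fun z => (\1_(band t) z)%:E * `|f z.1 - f z.2|%:E).
  apply: emeasurable_funM => //; apply/measurable_EFinP; apply: measurableT_comp => //.
  apply: measurable_funB; first exact: (measurableT_comp mf measurable_fst).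
  exact: (measurableT_comp mf measurable_snd).
have m2 : measurable_fun [set: R * R] (fun z => (\1_(band t) z)%:E * H z.1).
  by apply: emeasurable_funM => //; exact: (measurableT_comp mH measurable_fst).
apply: (ge0_le_integral2
  (F := fun z => (\1_(band t) z)%:E * `|f z.1 - f z.2|%:E)
  (G := fun z => (\1_(band t) z)%:E * H z.1)) => //.
move=> -[x y]; rewrite indicE; case: (boolP (_ \in _)) => [|_]; last by rewrite !mul0e.
rewrite inE /band/= !mul1e => xy.
pose a := Num.min x y; pose b := Num.max x y.
have -> : `|f x - f y|%R = `|f b - f a|%R.
  by rewrite /a /b; case: (leP x y) => _ //; rewrite distrC.
have [ab|ba] := ltP a b; last first.
  rewrite (_ : f b = f a) ?subrr ?normr0//.
  by congr (f _); move: ba; rewrite /a /b; case: (leP x y) => ? ?; lra.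
have -> : `|f b - f a|%:E = `|\int[mu]_(z in `[a, b]) (f' z)%:E|.
  by rewrite (continuous_derivable_FTC2 ab df).
apply: (le_trans (le_abse_integral _ _ _)) => //.
  by apply/measurable_EFinP/measurable_funTS; exact: continuous_measurable_fun.
rewrite integral_mkcond; apply: ge0_le_integral => //.
- by move=> z _; apply: erestrict_ge0.
- by apply/(measurable_restrictT _ _).1 => //; exact: measurable_funTS.
- exact: (measurableT_comp mbf' (pair1_measurable x)).
move=> z _; rewrite patchE; case: ifPn => [|_]; last by rewrite mule_ge0// lee_fin.
rewrite inE/= in_itv/= => /andP[az zb].
rewrite indicE mem_set ?mul1e// /band/=.
move: xy az zb; rewrite /a /b !ler_norml; case: (leP x y) => ? /andP[? ?] ? ?; apply/andP; split; lra.
Qed.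

End one_dimensional_estimates.

(** * The one-dimensional bump *)

Section bump_function.
Variables (R : realType) (w rho : R).
Hypothesis rho_bnd : 0 < rho < 2^-1.
Hypothesis w_eq : w = 1 \/ w = 2^-1.
Local Notation mu := (@lebesgue_measure R).

(** A Cantor rise on [[-1, 0]], a plateau of height 1 on [[0, 1]] and a Cantor fall on [[1, 2]]. On
    the plateau a tensor factor is 1, so differences in another coordinate stay visible. *)
Definition cantor_bump J (x : R) : R :=
  cantor_fun w rho J (x + 1) - cantor_fun w rho J (x - 1).

Lemma smooth_upto_bump k J : smooth_upto k (cantor_bump J).
Proof.
rewrite (_ : cantor_bump J = (fun x => cantor_fun w rho J (1 * x + 1)) \+
    (fun x => -1 * cantor_fun w rho J (1 * x + -1))); last first.
  by apply/funext => x; rewrite /= !mul1r mulN1r.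
apply: smooth_uptoD; last apply: smooth_uptoZ;
  by apply: smooth_upto_affine; exact: smooth_upto_cantor.
Qed.

Lemma bump_bnd J x : 0 <= cantor_bump J x <= 1.
Proof.
rewrite /cantor_bump subr_ge0 cantor_homo//=; last by lra.
have := cantor_bnd rho_bnd w_eq J (x + 1).
have := cantor_bnd rho_bnd w_eq J (x - 1); lra.
Qed.

Lemma bump_out J x : (x <= -1) || (2 <= x) -> cantor_bump J x = 0.
Proof.
case/orP => hx; rewrite /cantor_bump.
  by rewrite !(cantor0 w rho_bnd) ?subrr//; lra.
by rewrite !(cantor1 w rho_bnd) ?subrr//; lra.
Qed.

Lemma bump_left J x : x <= 1 -> cantor_bump J x = cantor_fun w rho J (x + 1).
Proof. by move=> x1; rewrite /cantor_bump [X in _ - X](cantor0 w rho_bnd) ?subr0//; lra. Qed.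

Lemma bump_in J x : 0 <= x <= 1 -> cantor_bump J x = 1.
Proof. by move=> hx; rewrite bump_left ?(cantor1 w rho_bnd)//; lra. Qed.

Lemma bump_dist J (B x y : R) :
  (forall x' y', x' - y' = x - y ->
    `|cantor_fun w rho J x' - cantor_fun w rho J y'| <= B) ->
  `|cantor_bump J x - cantor_bump J y| <= 2 * B.
Proof.
move=> HB; rewrite /cantor_bump.
rewrite (_ : _ - _ - _ = (cantor_fun w rho J (x + 1) - cantor_fun w rho J (y + 1)) -
  (cantor_fun w rho J (x - 1) - cantor_fun w rho J (y - 1))); last by ring.
apply: le_trans (ler_normB _ _) _; rewrite mulr2n mulrDl mul1r.
by apply: lerD; apply: HB; ring.
Qed.

(** Both translates are nondecreasing with total increment 1, so the variation is at most 2 whatever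
    [J], although the slopes may blow up. *)
Lemma integral_derive_bump J : (\int[mu]_x `|derive1 (cantor_bump J) x|%:E <= 2%:E)%E.
Proof.
have [dc sc] := smooth_upto_derive1 (smooth_upto_cantor w rho 1 J).
have cc := smooth_upto_continuous sc.
set c := cantor_fun w rho J in dc sc cc.
have ds a x : is_derive x (1 : R) (fun y => c (y + a)) (derive1 c (x + a)).
  have := @is_derive1_comp R c (fun y => y + a) x _ _ (dc _) (is_derive_shift _ _ _).
  by rewrite mulr1.
have hc : {homo c : x y / x <= y} by exact: cantor_homo.
have d0 x : 0 <= derive1 c x.
  by apply: (homo_derive_ge0 _ hc (dc x)) => y; case: (dc y).
have cs a : continuous (fun y => derive1 c (y + a) : R).
  move=> x; apply: (@continuous_comp _ _ _ (fun y => y + a) (derive1 c)); last exact: cc.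
  by apply: cvgD; [exact: cvg_id|exact: cvg_cst].
have is1 a : (\int[mu]_x (derive1 c (x + a))%:E = 1)%E.
  apply: (@integral_derive_transition _ (fun y => c (y + a)) _ (- a) (1 - a)) => //.
  - by lra.
  - by move=> x y xy; apply: hc; rewrite lerD2r.
  - by move=> x xa; apply: cantor0 => //; lra.
  - by move=> x xa; apply: cantor1 => //; lra.
apply: (@le_trans _ _
    (\int[mu]_x ((derive1 c (x + 1))%:E + (derive1 c (x + -1))%:E))%E).
  have [db sb] := smooth_upto_derive1 (smooth_upto_bump 1 J).
  have ms a : measurable_fun [set: R] (fun x => (derive1 c (x + a))%:E : \bar R).
    by apply/measurable_EFinP; exact: continuous_measurable_fun.
  apply: ge0_le_integral => //.
  - apply/measurable_EFinP; apply: measurableT_comp => //.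
    by apply: continuous_measurable_fun; exact: smooth_upto_continuous sb.
  - by apply: emeasurable_funD; exact: ms.
  - move=> x _; rewrite -EFinD lee_fin.
    have -> : derive1 (cantor_bump J) x = derive1 c (x + 1) - derive1 c (x + -1).
      rewrite derive1E; have [_ <-] := @is_deriveB R R R _ _ x 1 _ _ (ds 1 x) (ds (-1) x).
      by [].
    by apply: le_trans (ler_normB _ _) _; rewrite !ger0_norm.
rewrite ge0_integralD//; try by move=> x _; rewrite lee_fin.
- by rewrite !is1 -EFinD.
- by apply/measurable_EFinP; exact: continuous_measurable_fun.
- by apply/measurable_EFinP; exact: continuous_measurable_fun.
Qed.

Lemma integral_bump J : (\int[mu]_x (cantor_bump J x)%:E <= 3%:E)%E.
Proof.
apply: (@le_trans _ _ (\int[mu]_x (\1_(`[(-1), 2]%classic) x)%:E)%E).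
  apply: ge0_le_integral => //.
  - by move=> x _; rewrite lee_fin; case/andP : (bump_bnd J x).
  - apply/measurable_EFinP; apply: continuous_measurable_fun.
    exact: smooth_upto_continuous (smooth_upto_bump 0 J).
  - by apply/measurable_EFinP; exact: measurable_indic.
  - move=> x _; rewrite lee_fin indicE; case: (boolP (_ \in _)) => [_|/negP].
      by case/andP : (bump_bnd J x).
    rewrite inE/= in_itv/= => /negP; rewrite negb_and -!ltNge => /orP h.
    by rewrite bump_out//; case: h => /ltW ->; rewrite ?orbT.
rewrite integral_indic// setIT; apply: (@le_trans _ _ (2 - (-1))%:E); last by rewrite lee_fin; lra.
have := @lebesgue_measure_itv R `[(-1), 2]; rewrite /= lte_fin ifT; last by lra.
by move=> e; rewrite [leLHS]e -EFinD.
Qed.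

End bump_function.

(** * Tensor products as test functions *)

Section tensor_product.
Variables (R : realType) (N : nat).
Implicit Types (g : 'I_N -> R -> R) (x : 'rV[R]_N).

(** The factors may differ because a partial derivative replaces one of them; the class is then
    stable under [partial], which drives the induction in [Ck_tensor]. *)
Definition tensor g x : R := \prod_(i < N) g i (x ord0 i).

Lemma continuous_tensor g : (forall i, continuous (g i)) -> continuous (tensor g).
Proof.
move=> cg; apply: (@continuous_big R 'I_N *%R 1 xpredT); first by move=> z; exact: (@mul_continuous R z).
move=> i _ x; apply: (@continuous_comp _ _ _ (fun x : 'rV[R]_N => x ord0 i) (g i)).
  exact: coord_continuous.
exact: cg.
Qed.

(** Along the line through [x] in direction [i], all factors but the [i]-th are frozen, so the chain
    rule in one variable suffices. *)
Lemma is_derive_tensor g i x (d : R) : is_derive (x ord0 i) (1 : R) (g i) d ->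
  is_derive x (delta_mx ord0 i : 'rV[R]_N) (tensor g)
    (d * \prod_(j < N | j != i) g j (x ord0 j)).
Proof.
move=> dg; set C := \prod_(j < N | _) _.
pose phi (h : R) : R := tensor g (h *: delta_mx ord0 i + x).
have phiE : phi = fun h => C * g i (1 * h + x ord0 i).
  apply/funext => h; rewrite /phi /tensor (bigD1 i)//= mulrC; congr (_ * _).
    apply: eq_bigr => j ji; rewrite !mxE eqxx/= (negbTE ji).
    by rewrite mulr0 add0r.
  by rewrite !mxE !eqxx mulr1 mul1r.
have dphi : is_derive (0 : R) (1 : R) phi (d * C).
  have da : is_derive (0 : R) (1 : R) (fun h => 1 * h + x ord0 i) (1 : R).
    have d1 := @is_deriveZ R R R id 1 0 1 1 (is_derive_id _ _).
    have := @is_deriveD R R R _ (cst (x ord0 i)) 0 1 _ _ d1 (is_derive_cst _ _ _).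
    by rewrite addr0 /GRing.scale/= mulr1.
  have dg0 : is_derive (1 * 0 + x ord0 i) (1 : R) (g i) d by rewrite mulr0 add0r.
  have dc := @is_derive1_comp R (g i) _ 0 _ _ dg0 da.
  have := @is_deriveZ R R R _ C 0 1 _ dc.
  by rewrite phiE /GRing.scale/= mulr1 mulrC.
have [phid phiv] := dphi; apply: DeriveDef; first exact/derivable1P.
rewrite -phiv /derive.
rewrite [X in _ = lim (X @ _)](_ : _ = fun h : R => h^-1 *:
  ((tensor g \o shift x) (h *: delta_mx ord0 i : 'rV[R]_N) - tensor g x))//.
by apply/funext => h /=; rewrite /phi addr0 scale0r add0r [h *: 1]mulr1.
Qed.

Lemma partial_tensor g i : (forall j, smooth_upto 1 (g j)) ->
  partial i (tensor g) = tensor (fun j => if j == i then derive1 (g i) else g j).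
Proof.
move=> sg; apply/funext => x; have [dg _] := smooth_upto_derive1 (sg i).
have [_ e] := @is_derive_tensor g i x _ (dg (x ord0 i)); rewrite /partial e.
rewrite /tensor [in RHS](bigD1 i)//= eqxx; congr (_ * _).
by apply: eq_bigr => j /negbTE ->.
Qed.

Lemma Ck_tensor k g : (forall i, smooth_upto k (g i)) -> Ck k (tensor g).
Proof.
elim: k g => [|k IH] g sg /=.
  by split=> //; exact: continuous_tensor.
have sg1 i : smooth_upto 1 (g i).
  by elim: (k) (sg i) => // m IHm /smooth_uptoW.
have cg i := smooth_upto_continuous (sg i).
split; first exact: continuous_tensor.
split => [i x|i].
  have [dg _] := smooth_upto_derive1 (sg1 i).
  by have [] := @is_derive_tensor g i x _ (dg (x ord0 i)).
rewrite partial_tensor//; apply: IH => j; case: ifPn => _; last exact: smooth_uptoW.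
by have [] := smooth_upto_derive1 (sg i).
Qed.

Lemma Cc_infty_tensor g a b : (forall k i, smooth_upto k (g i)) ->
  (forall i t, (t <= a) || (b <= t) -> g i t = 0) -> Cc_infty (tensor g).
Proof.
move=> sg gab; split; first by move=> k; exact: Ck_tensor.
have cK : compact [set x : 'rV[R]_N | forall i, (x ord0 i \in `[a, b])%R].
  apply: (@rV_compact _ _ (fun=> `[a, b]%classic)) => i; exact: segment_compact.
apply: (subclosed_compact _ cK); first exact: closed_closure.
have /closure_id -> : closed [set x : 'rV[R]_N | forall i, (x ord0 i \in `[a, b])%R].
  by apply: compact_closed cK; exact: norm_hausdorff.
apply: closure_subset => x /= x0 i; rewrite in_itv/=.
apply/negPn/negP; rewrite negb_and -!ltNge => h.
move: x0; rewrite /tensor (bigD1 i)//= gab ?mul0r ?eqxx//.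
by case/orP : h => /ltW ->; rewrite ?orbT.
Qed.

End tensor_product.

(** * Differences of products *)

Section products.
Variable R : realType.

Lemma dist_prod_le_sum n (a b : 'I_n -> R) :
  (forall i, 0 <= a i <= 1) -> (forall i, 0 <= b i <= 1) ->
  `|\prod_(i < n) a i - \prod_(i < n) b i| <= \sum_(i < n) `|a i - b i|.
Proof.
elim: n a b => [|n IH] a b ha hb; first by rewrite !big_ord0 subrr normr0.
rewrite !big_ord_recl; set A := \prod_(i < n) _; set B := \prod_(i < n) _.
have /andP[A0 A1] : 0 <= A <= 1.
  rewrite prodr_ge0 => [|i _]; last by case/andP : (ha (lift ord0 i)).
  by rewrite prodr_ile1 => // i _; exact: ha.
rewrite (_ : _ - _ = (a ord0 - b ord0) * A + b ord0 * (A - B)); last by ring.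
apply: le_trans (ler_normD _ _) _; rewrite !normrM; apply: lerD.
  by rewrite ler_piMr// ger0_norm.
have /andP[b0 b1] := hb ord0.
apply: (@le_trans _ _ `|A - B|); first by rewrite ler_piMl// ger0_norm.
exact: IH.
Qed.

(** Telescoping, with each remaining factor [a j] or [b j] enlarged to [a j + b j]. Each summand
    thus keeps the product form that [integral_rV2_prod] requires, and its factors stay integrable
    on strips. *)
Lemma dist_prod_le_sum_prod n (a b : 'I_n -> R) :
  (forall i, 0 <= a i) -> (forall i, 0 <= b i) ->
  `|\prod_(i < n) a i - \prod_(i < n) b i| <=
  \sum_(i < n) \prod_(j < n) (if j == i then `|a j - b j| else a j + b j).
Proof.
elim: n a b => [|n IH] a b ha hb; first by rewrite !big_ord0 subrr normr0.
rewrite !big_ord_recl; set A := \prod_(i < n) _; set B := \prod_(i < n) _.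
have A0 : 0 <= A by apply: prodr_ge0 => i _.
rewrite (_ : _ - _ = (a ord0 - b ord0) * A + b ord0 * (A - B)); last by ring.
apply: le_trans (ler_normD _ _) _; rewrite !normrM; apply: lerD.
  rewrite eqxx ler_wpM2l// ger0_norm//.
  by apply: ler_prod => i _ /=; rewrite ha/= lerDl.
apply: (@le_trans _ _ ((a ord0 + b ord0) * `|A - B|)).
  by rewrite ler_wpM2r// ger0_norm// lerDr.
rewrite (le_trans (ler_wpM2l _ (IH _ _ _ _)))//; first by rewrite addr_ge0.
rewrite mulr_sumr; apply: ler_sum => i _.
by rewrite big_ord_recl.
Qed.

Lemma lee_prod (I : Type) (s : seq I) (a b : I -> \bar R) :
  (forall i, 0 <= a i)%E -> (forall i, a i <= b i)%E ->
  (\prod_(i <- s) a i <= \prod_(i <- s) b i)%E.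
Proof.
move=> a0 ab; elim: s => [|i s IH]; first by rewrite !big_nil.
by rewrite !big_cons lee_pmul// prode_ge0.
Qed.

End products.

(** * The Euclidean norm against the coordinates *)

Section euclidean_norm.
Variables (R : realType) (N : nat).
Implicit Types x : 'rV[R]_N.

Lemma enorm_ge0 x : 0 <= enorm x.
Proof. exact: sqrtr_ge0. Qed.

Lemma coord_le_enorm x i : `|x ord0 i| <= enorm x.
Proof.
rewrite -sqrtr_sqr ler_wsqrtr// (bigD1 i)//= lerDl.
by apply: sumr_ge0 => j _; exact: sqr_ge0.
Qed.

Lemma enorm_le_sum x : enorm x <= \sum_(i < N) `|x ord0 i|.
Proof.
have S0 (s : seq 'I_N) : 0 <= \sum_(i <- s) `|x ord0 i| by apply: sumr_ge0.
rewrite -(ger0_norm (S0 _)) -sqrtr_sqr ler_wsqrtr//.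
elim: (index_enum _) => [|i s IH]; first by rewrite !big_nil expr0n.
rewrite !big_cons sqrrD -addrA; apply: lerD; first by rewrite real_normK ?num_real.
by apply: (le_trans IH); rewrite lerDr mulrn_wge0// mulr_ge0.
Qed.

Lemma enorm_sub_eq0 x y : enorm (x - y) = 0 -> x = y.
Proof.
move=> e; apply/rowP => i; apply/eqP; rewrite -subr_eq0 -normr_eq0 eq_le normr_ge0 andbT.
by have := coord_le_enorm (x - y) i; rewrite e !mxE.
Qed.

Lemma measurable_enorm d (T : measurableType d) (f : T -> 'rV[R]_N) :
  (forall i, measurable_fun [set: T] (fun z => f z ord0 i : R)) ->
  measurable_fun [set: T] (fun z => enorm (f z)).
Proof.
move=> mf; apply: (measurableT_comp (f := @Num.sqrt R)).
  by apply: nondecreasing_measurable => // x y; exact: ler_wsqrtr.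
by apply: measurable_sum => i; exact: measurable_funX.
Qed.

Lemma measurable_enorm_diff : measurable_fun [set: 'rV[R]_N * 'rV[R]_N]
  (fun z => enorm (z.1 - z.2)).
Proof.
apply: measurable_enorm => i; under eq_fun do rewrite !mxE.
apply: measurable_funB.
  exact: (measurableT_comp (@measurable_rV_coord R N i) measurable_fst).
exact: (measurableT_comp (@measurable_rV_coord R N i) measurable_snd).
Qed.

End euclidean_norm.

(** * Gradient and near-diagonal differences of a tensor power *)

Section tensor_estimates.
Variables (R : realType) (N : nat) (psi : R -> R).
Hypothesis smooth_psi : forall k, smooth_upto k psi.
Hypothesis psi_bnd : forall t, 0 <= psi t <= 1.
Local Notation mu := (@lebesgue_measure R).
Hypothesis integral_psi : (\int[mu]_t (psi t)%:E <= 3%:E)%E.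
Hypothesis integral_dpsi : (\int[mu]_t `|derive1 psi t|%:E <= 2%:E)%E.

Local Notation u := (tensor (fun _ : 'I_N => psi)).

Let psi0 t : 0 <= psi t. Proof. by case/andP : (psi_bnd t). Qed.

Let cpsi : continuous psi := smooth_upto_continuous (smooth_psi 0).

Let dpsi : forall t, is_derive t (1 : R) psi (derive1 psi t).
Proof. by have [] := smooth_upto_derive1 (smooth_psi 1). Qed.

Let cdpsi : continuous (derive1 psi : R -> R).
Proof.
by have [_] := smooth_upto_derive1 (smooth_psi 1); exact: smooth_upto_continuous.
Qed.

Let mpsi : measurable_fun [set: R] psi.
Proof. exact: continuous_measurable_fun. Qed.

Let mdpsi : measurable_fun [set: R] (derive1 psi : R -> R).
Proof. exact: continuous_measurable_fun. Qed.

Lemma measurable_tensor (g : 'I_N -> R -> R) :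
  (forall i, measurable_fun [set: R] (g i)) ->
  measurable_fun [set: 'rV[R]_N] (tensor g).
Proof.
move=> mg; apply: measurable_prod => i _.
exact: (measurableT_comp (mg i) (@measurable_rV_coord R N i)).
Qed.

Local Open Scope ereal_scope.

(** Each partial derivative integrates to one factor at most 2 and [N - 1] factors at most 3;
    replacing 2 by 3 gives [3 ^+ N] for each of the [N] directions. *)
Lemma gradient_norm_le : 'N[lebesgue_rV R N]_1[(fun x => (enorm (gradient u x))%:E)]
  <= (N%:R * (3 ^+ N))%:E.
Proof.
pose g i := fun j : 'I_N => if j == i then derive1 psi : R -> R else psi.
have pE i : partial i u = tensor (g i).
  by rewrite partial_tensor.
have mg i j : measurable_fun [set: R] (g i j) by rewrite /g; case: ifP.
have mt i := measurable_tensor (mg i).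
have mabs i : measurable_fun [set: 'rV[R]_N] (fun x => `|tensor (g i) x|%:E).
  by apply/measurable_EFinP; exact: measurableT_comp.
rewrite Lnorm1.
apply: (@le_trans _ _ (\int[lebesgue_rV R N]_x \sum_(i < N) `|tensor (g i) x|%:E)).
  apply: ge0_le_integral => //.
  - apply/measurable_EFinP; apply: measurableT_comp => //; apply: measurable_enorm => i.
    rewrite (_ : (fun _ => _) = tensor (g i)); first exact: mt.
    by apply/funext => x; rewrite mxE pE.
  - exact: emeasurable_sum.
  move=> x _; rewrite sumEFin lee_fin ger0_norm ?enorm_ge0//.
  apply: le_trans (enorm_le_sum _) _; apply: ler_sum => i _.
  by rewrite mxE pE.
rewrite ge0_integral_sum//.
apply: (@le_trans _ _ (\sum_(i < N) (3 ^+ N)%:E)); last first.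
  by rewrite sumEFin lee_fin sumr_const card_ord mulr_natl.
apply: lee_sum => i _.
under eq_integral => x _ do rewrite normr_prod -prodEFin.
rewrite (@integral_rV_prod _ _ (fun j t => `|g i j t|%:E))//; last first.
  by move=> j; apply/measurable_EFinP; exact: (measurableT_comp (@normr_measurable R setT) (mg i j)).
rewrite [leRHS](_ : _ = \prod_(j < N) 3%:E); last first.
  by rewrite prodEFin prodr_const card_ord.
apply: lee_prod => j; first by apply: integral_ge0.
rewrite /g; case: ifP => _; first by apply: (le_trans integral_dpsi); rewrite lee_fin ler_nat.
by under eq_integral => t _ do rewrite ger0_norm//.
Qed.

(** The indicator of a sup-norm neighbourhood of the diagonal. It dominates that of the Euclidean
    one and factors over the coordinates. *)
Definition in_bands t (z : 'rV[R]_N * 'rV[R]_N) : R :=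
  \prod_(i < N) \1_(band t) (z.1 ord0 i, z.2 ord0 i).

Lemma in_bands_ge0 t z : (0 <= in_bands t z)%R.
Proof. by apply: prodr_ge0 => i _. Qed.

Lemma in_bands1 t z : (enorm (z.1 - z.2) <= t)%R -> in_bands t z = 1%R.
Proof.
move=> zt; rewrite /in_bands big1// => i _; rewrite indicE mem_set// /band/=.
apply: le_trans zt; have := coord_le_enorm (z.1 - z.2) i.
by rewrite !mxE.
Qed.

Lemma measurable_rV2_coord i : measurable_fun [set: 'rV[R]_N * 'rV[R]_N]
  (fun z => (z.1 ord0 i, z.2 ord0 i) : R * R).
Proof.
apply: measurable_fun_pair.
  exact: (measurableT_comp (@measurable_rV_coord R N i) measurable_fst).
exact: (measurableT_comp (@measurable_rV_coord R N i) measurable_snd).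
Qed.

Lemma measurable_in_bands t : measurable_fun [set: 'rV[R]_N * 'rV[R]_N] (in_bands t).
Proof.
apply: measurable_prod => i _.
apply: (measurableT_comp _ (measurable_rV2_coord i)).
exact: measurable_indic (measurable_band t).
Qed.

Lemma measurable_tensor_diff : measurable_fun [set: 'rV[R]_N * 'rV[R]_N]
  (fun z => u z.1 - u z.2)%R.
Proof.
have mu : measurable_fun [set: 'rV[R]_N] u by exact: measurable_tensor.
apply: measurable_funB; first exact: (measurableT_comp mu measurable_fst).
exact: (measurableT_comp mu measurable_snd).
Qed.

(** After telescoping, each coordinate with [psi x + psi y] costs [2t * 3 + 2t * 3 = 12t], and the
    one carrying the difference costs at most [12t * min 1 t]. The factor [t] serves near the
    diagonal, the factor 1 far from it. *)
Lemma integral_in_bands_diff t : (0 <= t)%R ->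
  \int[lebesgue_rV2 R N]_z (in_bands t z * `|u z.1 - u z.2|)%:E <=
  (N%:R * (12 * t) ^+ N * Num.min 1 t)%:E.
Proof.
move=> t0.
pose F (i j : 'I_N) (z : R * R) : \bar R := (\1_(band t) z)%:E *
  (if j == i then `|psi z.1 - psi z.2| else psi z.1 + psi z.2)%:E.
have F0 i j z : 0 <= F i j z.
  by rewrite mule_ge0// lee_fin//; case: ifP => // _; rewrite addr_ge0.
have m1 : measurable_fun [set: R * R] (fun z => psi z.1).
  exact: (measurableT_comp mpsi measurable_fst).
have m2 : measurable_fun [set: R * R] (fun z => psi z.2).
  exact: (measurableT_comp mpsi measurable_snd).
have mF i j : measurable_fun [set: R * R] (F i j).
  apply: emeasurable_funM; first exact: measurable_indic_band.
  apply/measurable_EFinP; case: (j == i); last exact: measurable_funD.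
  by apply: measurableT_comp => //; exact: measurable_funB.
apply: (@le_trans _ _ (\int[lebesgue_rV2 R N]_z
    \sum_(i < N) \prod_(j < N) F i j (z.1 ord0 j, z.2 ord0 j))).
  apply: ge0_le_integral => //.
  - by move=> z _; rewrite lee_fin mulr_ge0// in_bands_ge0.
  - apply/measurable_EFinP; apply: measurable_funM; first exact: measurable_in_bands.
    by apply: measurableT_comp => //; exact: measurable_tensor_diff.
  - apply: emeasurable_sum => i; apply: emeasurable_prod => j.
    exact: (measurableT_comp (mF i j) (measurable_rV2_coord j)).
  move=> z _.
  rewrite (_ : \sum_(i < N) _ = (\sum_(i < N) \prod_(j < N) (\1_(band t)
    (z.1 ord0 j, z.2 ord0 j) * (if j == i then `|psi (z.1 ord0 j) - psi (z.2 ord0 j)|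
     else psi (z.1 ord0 j) + psi (z.2 ord0 j))))%:E); last first.
    by rewrite -sumEFin; apply: eq_bigr => i _; rewrite -prodEFin.
  rewrite lee_fin; under eq_bigr do rewrite big_split/=.
  rewrite -mulr_sumr ler_wpM2l//; first exact: in_bands_ge0.
  exact: dist_prod_le_sum_prod.
rewrite ge0_integral_sum//; last 2 first.
- move=> i; apply: emeasurable_prod => j.
  exact: (measurableT_comp (mF i j) (measurable_rV2_coord j)).
- by move=> i z _; exact: prode_ge0.
apply: (@le_trans _ _ (\sum_(i < N) ((12 * t) ^+ N * Num.min 1 t)%:E)); last first.
  by rewrite sumEFin lee_fin sumr_const card_ord -mulrA [leRHS]mulr_natl.
apply: lee_sum => i _; rewrite (integral_rV2_prod (mF i) (F0 i)).
have sum_le : \int[mu]_x \int[mu]_y ((\1_(band t) (x, y))%:E * (psi x + psi y)%:E) <=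
    (12 * t)%:E.
  have mpsiE : measurable_fun [set: R] (fun x => (psi x)%:E : \bar R).
    exact/measurable_EFinP.
  under eq_integral => x _.
    under eq_integral => y _ do rewrite EFinD ge0_muleDr ?lee_fin//.
    rewrite ge0_integralD//; last 4 first.
    - by move=> y _; rewrite mule_ge0 ?lee_fin.
    - apply: emeasurable_funM => //.
      exact: (measurableT_comp (measurable_indic_band t) (pair1_measurable x)).
    - by move=> y _; rewrite mule_ge0 ?lee_fin.
    - apply: emeasurable_funM => //.
      exact: (measurableT_comp (measurable_indic_band t) (pair1_measurable x)).
    over.
  rewrite ge0_integralD//; last 4 first.
  - by move=> x _; apply: integral_ge0 => y _; rewrite mule_ge0 ?lee_fin.
  - apply: (measurable_integral2 (F := fun z => (\1_(band t) z)%:E * (psi z.1)%:E)).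
      by apply: emeasurable_funM; [exact: measurable_indic_band|exact/measurable_EFinP].
    by move=> z; rewrite mule_ge0 ?lee_fin.
  - by move=> x _; apply: integral_ge0 => y _; rewrite mule_ge0 ?lee_fin.
  - apply: (measurable_integral2 (F := fun z => (\1_(band t) z)%:E * (psi z.2)%:E)).
      by apply: emeasurable_funM; [exact: measurable_indic_band|exact/measurable_EFinP].
    by move=> z; rewrite mule_ge0 ?lee_fin.
  rewrite integral_bandl// integral_bandr//.
  rewrite (_ : (12 * t)%:E = (2 * t)%:E * 3%:E + (2 * t)%:E * 3%:E); last first.
    by rewrite -!EFinM -EFinD; congr (_%:E); ring.
  by apply: leeD; apply: lee_wpmul2l => //; rewrite lee_fin mulr_ge0.
have diff_le : \int[mu]_x \int[mu]_y ((\1_(band t) (x, y))%:E * `|psi x - psi y|%:E) <=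
    (12 * t * Num.min 1 t)%:E.
  rewrite minr_pMr ?mulr_ge0// mulr1 EFin_min.
  (* The bound [12 * t] comes from [|psi x - psi y| <= psi x + psi y], the bound [12 * t ^ 2] from
     the total variation, which gives [4 * t ^ 2 * 2]. *)
  rewrite le_min; apply/andP; split.
    apply: le_trans sum_le; apply: (ge0_le_integral2
      (F := fun z => (\1_(band t) z)%:E * `|psi z.1 - psi z.2|%:E)
      (G := fun z => (\1_(band t) z)%:E * (psi z.1 + psi z.2)%:E)).
    - apply: emeasurable_funM; first exact: measurable_indic_band.
      apply/measurable_EFinP; apply: measurableT_comp => //; exact: measurable_funB.
    - apply: emeasurable_funM; first exact: measurable_indic_band.
      apply/measurable_EFinP; exact: measurable_funD.
    - by move=> z; rewrite mule_ge0 ?lee_fin.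
    - move=> z; rewrite -!EFinM lee_fin ler_wpM2l//.
      by apply: le_trans (ler_normB _ _) _; rewrite !ger0_norm.
  apply: (le_trans (integral_band_dist t0 dpsi cdpsi)).
  apply: (@le_trans _ _ ((4 * t ^+ 2)%:E * 2%:E)).
    by apply: lee_wpmul2l => //; rewrite lee_fin mulr_ge0// sqr_ge0.
  rewrite -EFinM lee_fin; have := sqr_ge0 t; rewrite expr2; lra.
rewrite [leRHS](_ : _ = \prod_(j < N)
    (12 * t * (if j == i then Num.min 1 t else 1))%:E); last first.
  rewrite prodEFin big_split/= prodr_const card_ord; congr (_ * _)%:E.
  by rewrite -big_mkcond big_pred1_eq.
apply: lee_prod => j.
  by apply: integral_ge0 => x _; apply: integral_ge0.
by rewrite /F; case: ifP => _ //; rewrite mulr1.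
Qed.

End tensor_estimates.

(** * Summation over dyadic-type shells *)

Section shells.
Variable R : realType.

Lemma geometric_sum_le (b : R) n : 0 <= b < 1 -> \sum_(k < n) b ^+ k <= (1 - b)^-1.
Proof.
move=> /andP[b0 b1]; elim: n => [|n IH].
  by rewrite big_ord0 invr_ge0 subr_ge0 ltW.
rewrite big_ord_recl expr0.
under eq_bigr do rewrite lift0 exprS.
rewrite -mulr_sumr; apply: (@le_trans _ _ (1 + b * (1 - b)^-1)).
  by rewrite lerD2l ler_wpM2l.
by rewrite -[X in X + _](@divff _ (1 - b)) ?subr_eq0 ?gt_eqF// -mulrDl subrK mul1r.
Qed.

(* [k - J] is the truncated subtraction: the first [J] terms equal 1. *)
Lemma delayed_geometric_sum_le (b : R) J n : 0 <= b < 1 ->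
  \sum_(k < n) b ^+ (k - J) <= J%:R + (1 - b)^-1.
Proof.
move=> hb; elim: J n => [|J IH] n.
  by under eq_bigr do rewrite subn0; rewrite add0r geometric_sum_le.
case: n => [|n].
  by rewrite big_ord0 addr_ge0// invr_ge0 subr_ge0 ltW//; case/andP : hb.
rewrite big_ord_recl sub0n expr0 -natr1 addrAC [leRHS]addrC lerD2l.
by under eq_bigr do rewrite lift0 subSS; exact: IH.
Qed.

Lemma exists_shell (rho x : R) : 0 < rho < 1 -> 0 < x <= 1 ->
  exists k, rho ^+ k.+1 < x <= rho ^+ k.
Proof.
move=> /andP[r0 r1] /andP[x0 x1].
have ex : exists n, rho ^+ n < x.
  have : (rho ^+ n)%R @[n --> \oo] --> (0 : R).
    by apply: cvg_expr; rewrite ger0_norm ?ltW.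
  move=> /cvgrPdist_lt /(_ _ x0) [n _ /(_ n (leqnn n))]; rewrite sub0r normrN => h.
  by exists n; apply: le_lt_trans h; exact: ler_norm.
case: (ex_minnP ex) => -[|k] hk hmin.
  by move: hk; rewrite expr0 ltNge x1.
exists k; rewrite hk/= leNgt; apply/negP => /hmin.
by rewrite ltnn.
Qed.

Local Open Scope ereal_scope.

(** At every point one term of the series already dominates [f]; the regions where different terms
    do so may overlap, so no partition has to be built. *)
Lemma ge0_integral_le_series d (T : measurableType d) (m : {measure set T -> \bar R})
    (f : T -> \bar R) (g : nat -> T -> \bar R) (c : nat -> R) (S : R) :
  measurable_fun [set: T] f -> (forall k, measurable_fun [set: T] (g k)) ->
  (forall z, 0 <= f z) -> (forall k z, 0 <= g k z) ->
  (forall z, exists k, f z <= g k z) ->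
  (forall k, \int[m]_z g k z <= (c k)%:E) ->
  (forall n, \sum_(k < n) c k <= S)%R ->
  \int[m]_z f z <= S%:E.
Proof.
move=> mf mg f0 g0 fg gc cS.
apply: (@le_trans _ _ (\int[m]_z (\sum_(k <oo) g k z))).
  apply: ge0_le_integral => //.
    by apply: ge0_emeasurable_sum => [k z _ _|k _]; [exact: g0|exact: mg].
  move=> z _; have [k hk] := fg z; apply: (le_trans hk).
  apply: le_trans (nneseries_lim_ge k.+1 _) => //.
  by rewrite big_nat_recr//= leeDr// sume_ge0.
rewrite integral_nneseries//; apply: lime_le.
  by apply: is_cvg_nneseries => k _ _; exact: integral_ge0.
apply: nearW => n; rewrite big_mkord.
apply: (@le_trans _ _ (\sum_(k < n) (c k)%:E)); first exact: lee_sum.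
by rewrite sumEFin lee_fin.
Qed.

End shells.

(** * Upper bound for the Gagliardo seminorm *)

Section gagliardo_estimate.
Variables (R : realType) (N : nat) (w rho sigma r : R).
Hypothesis rho_bnd : 0 < rho < 2^-1.
Hypothesis w_eq : w = 1 \/ w = 2^-1.
Hypothesis sigma_bnd : 0 < sigma < 1.
Hypothesis r_gt1 : 1 < r.
Hypothesis w_rho : w `^ (r - 1) = rho `^ (sigma * r - 1).

Let rho0 : 0 < rho. Proof. by case/andP : rho_bnd. Qed.
Let rho1 : rho < 1. Proof. by case/andP : rho_bnd => _ h; apply: lt_trans h _; lra. Qed.
Let w0 : 0 < w. Proof. by case: w_eq => ->; lra. Qed.
Let gam := 1 - 2 * rho.
Let gam0 : 0 < gam. Proof. by rewrite /gam; case/andP : rho_bnd => *; lra. Qed.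
Let gam1 : gam <= 1. Proof. by rewrite /gam; case/andP : rho_bnd => *; lra. Qed.

Local Notation psi := (cantor_bump w rho).
Local Notation u J := (tensor (fun _ : 'I_N => psi J)).
Local Notation e := (N%:R + sigma * r).

Let e0 : 0 < e.
Proof. by case/andP : sigma_bnd => s0 _; rewrite ltr_wpDl// mulr_gt0// (lt_trans _ r_gt1). Qed.

Lemma tensor_bump_dist_le1 J x y : `|u J x - u J y| <= 1.
Proof.
have h x' : 0 <= u J x' <= 1.
  rewrite prodr_ge0 => [|i _]; last by case/andP : (bump_bnd rho_bnd w_eq J (x' ord0 i)).
  by rewrite prodr_ile1// => i _; exact: bump_bnd.
by have := h x; have := h y; rewrite ler_norml; lra.
Qed.

(** For [k <= J] this is [cantor_holder]; for [k > J] it is [cantor_lipschitz], as [(w / rho) ^ J *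
    rho ^ k = w ^ J * rho ^ (k - J)]. In [C], [N] counts coordinates, 2 the translates in the bump,
    and [1 + L] covers both cases. *)
Lemma tensor_bump_dist : exists2 C : R, 0 < C & forall J k x y,
  enorm (x - y) <= gam * rho ^+ k ->
  `|u J x - u J y| <= C * (w ^+ minn k J * rho ^+ (k - J)).
Proof.
have [L L0 HL] := cantor_lipschitz rho_bnd w_eq.
exists (1 + N%:R * (2 * (1 + L))) => [|J k x y xy].
  by rewrite ltr_pwDl// mulr_ge0// mulr_ge0// addr_ge0// ltW.
apply: (@le_trans _ _ (N%:R * (2 * (1 + L)) * (w ^+ minn k J * rho ^+ (k - J)))); last first.
  by rewrite ler_wpM2r ?lerDr// mulr_ge0// exprn_ge0// ltW.
apply: le_trans (dist_prod_le_sum _ _) _ => [i|i|]; [exact: bump_bnd|exact: bump_bnd|].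
apply: (@le_trans _ _ (\sum_(i < N) (2 * ((1 + L) * (w ^+ minn k J * rho ^+ (k - J)))))).
  apply: ler_sum => i _; apply: bump_dist => x' y' exy.
  have {}xy : `|x' - y'| <= gam * rho ^+ k.
    by rewrite exy; apply: le_trans xy; have := coord_le_enorm (x - y) i; rewrite !mxE.
  have [kJ|/ltnW Jk] := leqP k J.
    rewrite (eqP (kJ : k - J == 0)%N) expr0 mulr1.
    apply: (le_trans (cantor_holder rho_bnd w_eq kJ xy)).
    by rewrite ler_peMl ?exprn_ge0 ?(ltW w0)// lerDl ltW.
  apply: (le_trans (HL J x' y')).
  apply: (@le_trans _ _ (L * (w / rho) ^+ J * rho ^+ k)).
    apply: ler_wpM2l; first by rewrite mulr_ge0 ?exprn_ge0 ?divr_ge0// ltW.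
    by apply: (le_trans xy); rewrite ler_piMl// exprn_ge0// ltW.
  rewrite -{1}(subnK Jk) exprD expr_div_n -!mulrA.
  rewrite (_ : _ * (_ * (_ * _)) = L * (w ^+ J * rho ^+ (k - J))); last first.
    by field; rewrite expf_neq0// gt_eqF.
  by rewrite ler_wpM2r ?lerDr// mulr_ge0// exprn_ge0// ltW.
rewrite sumr_const card_ord -[leLHS]mulr_natl le_eqVlt; apply/orP; left.
by apply/eqP; ring.
Qed.

(** [beta] is the decay per shell below the smoothing scale, [delta] the decay per shell at large
    distance; they are below 1 because [sigma < 1] and [sigma * r > 0]. *)
Let beta := rho `^ (r - sigma * r).
Let delta := rho `^ (sigma * r).

(** The left side is oscillation to the power [r - 1], times kernel, times the L^1 bound at distance
    [rho ^+ k]. By [w_rho] all powers cancel for [k <= J]; only the excess [k - J] remains. *)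
Lemma shell_exponents J k :
  (w ^+ minn k J * rho ^+ (k - J)) `^ (r - 1) / (rho ^+ k) `^ e * (rho ^+ k) ^+ N * rho ^+ k
  = beta ^+ (k - J).
Proof.
have kE : k%:R = (minn k J)%:R + (k - J)%:R :> R by rewrite -natrD minnE subnK ?leq_subr.
rewrite powRM ?exprn_ge0 ?(ltW w0) ?(ltW rho0)//.
rewrite !powR_exprn// -exprM -!(powR_mulrn _ (ltW rho0)) -(powR_mulrn (k - J) (powR_ge0 _ _)).
rewrite /beta -powRrM -powRN [(minn k J)%:R * _]mulrC [w `^ _]powRrM w_rho -powRrM !(powR_add rho0).
by congr (_ `^ _); rewrite natrM kE; ring.
Qed.

Lemma far_exponents k :
  ((rho ^- k) `^ e)^-1 * (rho ^- k.+1) ^+ N = rho ^- N * delta ^+ k.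
Proof.
rewrite -!(powR_mulrn _ (ltW rho0)) -!(powR_mulrn _ (powR_ge0 _ _)) -!powRN.
rewrite -(powR_mulrn N (powR_ge0 _ _)) -!powRrM !(powR_add rho0).
by congr (_ `^ _); rewrite -natr1; ring.
Qed.

(** Within the gap [gam], the power [r - 1] of the difference is bounded by [tensor_bump_dist] and
    the remaining power is integrated. Farther away differences are at most 1 and the kernel beats
    the volume. The first [J] shells cost a constant each, all others sum to a constant. *)
Lemma gagliardo_integral_le : exists2 K : R, 0 < K & forall J,
  (\int[lebesgue_rV2 R N]_z
     (`|u J z.1 - u J z.2| `^ r / enorm (z.1 - z.2) `^ (N%:R + sigma * r))%:E <=
   (K * J.+1%:R)%:E)%E.
Proof.
have [C C0 HC] := tensor_bump_dist.
pose M := N%:R * 12 ^+ N : R.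
pose A := M * (C `^ (r - 1) / (gam * rho) `^ e).
pose B := M * ((gam `^ e)^-1 * rho ^- N).
have M0 : 0 <= M by rewrite mulr_ge0// exprn_ge0.
have A0 : 0 <= A by rewrite mulr_ge0// divr_ge0 ?powR_ge0.
have B0 : 0 <= B.
  by rewrite mulr_ge0// mulr_ge0 ?invr_ge0 ?powR_ge0// exprn_ge0// ltW.
have hbeta : 0 <= beta < 1.
  apply: powR_lt1; first by rewrite rho0.
  case/andP : sigma_bnd => _ s1.
  by rewrite subr_gt0 gtr_pMl// (lt_trans _ r_gt1).
have hdelta : 0 <= delta < 1.
  apply: powR_lt1; first by rewrite rho0.
  by case/andP : sigma_bnd => s0 _; rewrite mulr_gt0// (lt_trans _ r_gt1).
exists (1 + A * (1 + (1 - beta)^-1) + B * (1 - delta)^-1) => [|J].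
  rewrite -addrA ltr_pwDl// addr_ge0// mulr_ge0// ?addr_ge0// invr_ge0 subr_ge0 ltW//.
    by case/andP : hbeta.
  by case/andP : hdelta.
have rho01 : 0 < rho < 1 by rewrite rho0.
pose t k := gam * rho ^+ k; pose t' k := gam * rho ^- k.
(* [a k] serves on the near shell between [t k.+1] and [t k], [b k] on the far shell between [t' k]
   and [t' k.+1]. Kernels are evaluated at the inner radius, strips are taken at the outer one. *)
pose a k := (C * (w ^+ minn k J * rho ^+ (k - J))) `^ (r - 1) / (t k.+1) `^ e.
pose b k := (t' k `^ e)^-1.
have a0 k : 0 <= a k by rewrite divr_ge0 ?powR_ge0.
have b0 k : 0 <= b k by rewrite invr_ge0 powR_ge0.
have t0 k : 0 <= t k by rewrite mulr_ge0 ?exprn_ge0// ltW.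
have t'0 k : 0 <= t' k by rewrite mulr_ge0 ?invr_ge0 ?exprn_ge0// ltW.
have su i : smooth_upto i (psi J) by exact: smooth_upto_bump.
have bu x : 0 <= psi J x <= 1 by exact: bump_bnd.
have iu := integral_bump rho_bnd w_eq J.
have idu := integral_derive_bump rho_bnd w_eq J.
pose D (z : 'rV[R]_N * 'rV[R]_N) := `|u J z.1 - u J z.2|.
have mD : measurable_fun setT D.
  by apply: measurableT_comp => //; exact: measurable_tensor_diff.
have D0 z : 0 <= D z by exact: normr_ge0.
have D1 z : D z <= 1 by exact: tensor_bump_dist_le1.
have mB s : measurable_fun [set: 'rV[R]_N * 'rV[R]_N] (fun z => in_bands s z * D z).
  by apply: measurable_funM => //; exact: measurable_in_bands.
have intB := integral_in_bands_diff N su bu iu idu.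
apply: (@ge0_integral_le_series _ _ _ _ _
  (fun k z => (a k * (in_bands (t k) z * D z) + b k * (in_bands (t' k.+1) z * D z))%:E)
  (fun k => A * beta ^+ (k - J) + B * delta ^+ k)).
- apply/measurable_EFinP; apply: measurable_funM.
    exact: (measurableT_comp (measurable_powR r) mD).
  under eq_fun do rewrite -powRN.
  apply: (measurableT_comp (measurable_powR (- e))); exact: measurable_enorm_diff.
- move=> k; apply/measurable_EFinP; apply: measurable_funD;
    by apply: measurable_funM => //; exact: mB.
- by move=> z; rewrite lee_fin divr_ge0 ?powR_ge0.
- move=> k z; rewrite lee_fin.
  by rewrite addr_ge0// mulr_ge0// mulr_ge0// in_bands_ge0.
- move=> z; rewrite -/(D z); set d := enorm _.
  have dge0 : 0 <= d by exact: enorm_ge0.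
  have DrE : D z `^ r <= D z `^ (r - 1) * D z.
    have [->|Dz0] := eqVneq (D z) 0; first by rewrite mulr0 powR0// gt_eqF// (lt_trans _ r_gt1).
    rewrite -{3}[D z]powRr1// -powRD ?subrK//.
    by apply/implyP.
  have r1 : 0 <= r - 1 by rewrite subr_ge0 ltW.
  (* On the diagonal the integrand is 0 and any index works. *)
  have [dpos|d0] := ltP 0 d; last first.
    exists 0%N; rewrite lee_fin.
    have zz : z.1 = z.2 by apply: enorm_sub_eq0; apply/eqP; rewrite eq_le d0.
    by rewrite /D zz subrr normr0 powR0 ?mul0r ?mulr0 ?addr0// gt_eqF// (lt_trans _ r_gt1).
  have [dg|gd] := leP d gam.
    have [|k /andP[k1 k2]] := @exists_shell R rho (d / gam) rho01 _.
      by rewrite divr_gt0//= ler_pdivrMr// mul1r.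
    have dt : d <= t k by rewrite /t mulrC -ler_pdivrMr.
    have td : t k.+1 <= d by rewrite /t mulrC -ler_pdivlMr// ltW.
    exists k; rewrite lee_fin in_bands1//.
    apply: (@le_trans _ _ (a k * (1 * D z))); last first.
      by rewrite lerDl mulr_ge0// mulr_ge0// in_bands_ge0.
    rewrite mul1r /a mulrAC; apply: ler_pM; rewrite ?powR_ge0 ?invr_ge0 ?powR_ge0//.
      apply: (le_trans DrE); rewrite ler_wpM2r//.
      apply: ge0_ler_powR; rewrite ?nnegrE//; last exact: HC.
      by rewrite mulr_ge0 ?(ltW C0)// mulr_ge0// exprn_ge0// ltW.
    have tk0 : 0 < t k.+1 by rewrite mulr_gt0// exprn_gt0.
    rewrite lef_pV2 ?posrE ?powR_gt0//.
    by apply: ge0_ler_powR; rewrite ?nnegrE// ltW.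
  have [|k /andP[k1 k2]] := @exists_shell R rho (gam / d) rho01 _.
    by rewrite divr_gt0//= ler_pdivrMr// mul1r ltW.
  have dt : d <= t' k.+1.
    by rewrite /t' ler_pdivlMr ?exprn_gt0// mulrC -ler_pdivlMr// ltW.
  have td : t' k <= d.
    by rewrite /t' ler_pdivrMr ?exprn_gt0// mulrC -ler_pdivrMr.
  exists k; rewrite lee_fin [X in b k * (X * _)]in_bands1//.
  apply: (@le_trans _ _ (b k * (1 * D z))); last first.
    by rewrite lerDr mulr_ge0// mulr_ge0// in_bands_ge0.
  rewrite mul1r mulrC; apply: ler_pM; rewrite ?powR_ge0 ?invr_ge0 ?powR_ge0//.
    have tk0 : 0 < t' k by rewrite mulr_gt0// invr_gt0 exprn_gt0.
    rewrite lef_pV2 ?posrE ?powR_gt0//.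
    by apply: ge0_ler_powR; rewrite ?nnegrE// ltW.
  apply: (le_trans DrE); rewrite ler_piMl//.
  rewrite -[leRHS](congr1 (@^~ (r - 1)) (powR1 R)).
  by apply: ge0_ler_powR; rewrite ?nnegrE.
- move=> k.
  under eq_integral => z _ do rewrite EFinD (EFinM (a k)) (EFinM (b k)).
  have mBE s : measurable_fun [set: 'rV[R]_N * 'rV[R]_N]
      (fun z => (in_bands s z * D z)%:E : \bar R) by exact/measurable_EFinP.
  have BE0 s z : (0 <= (in_bands s z * D z)%:E)%E by rewrite lee_fin mulr_ge0// in_bands_ge0.
  rewrite ge0_integralD//; first last.
  - by apply: emeasurable_funM => //; exact: mBE.
  - by move=> z _; rewrite mule_ge0// lee_fin.
  - by apply: emeasurable_funM => //; exact: mBE.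
  - by move=> z _; rewrite mule_ge0// lee_fin.
  rewrite !ge0_integralZl_EFin//.
  rewrite EFinD; apply: leeD.
    apply: le_trans (lee_wpmul2l _ (intB _ (t0 k))) _; first by rewrite lee_fin.
    rewrite -EFinM lee_fin.
    have tr : t k <= rho ^+ k by rewrite ler_piMl// exprn_ge0// ltW.
    apply: (@le_trans _ _ (a k * (N%:R * (12 * rho ^+ k) ^+ N * rho ^+ k))).
      rewrite ler_wpM2l//; apply: ler_pM => //.
      - by rewrite mulr_ge0// exprn_ge0// mulr_ge0.
      - by rewrite le_min ler01 t0.
      - have h1 : 0 <= 12 * t k by rewrite mulr_ge0.
        have h2 : 0 <= 12 * rho ^+ k by rewrite mulr_ge0// exprn_ge0// ltW.
        by rewrite ler_wpM2l// lerXn2r ?nnegrE// ler_wpM2l.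
      - by rewrite ge_min tr orbT.
    have tE : t k.+1 = gam * rho * rho ^+ k by rewrite /t exprS mulrA.
    rewrite -shell_exponents /a tE /A /M.
    rewrite [(C * _) `^ _]powRM ?(ltW C0)//; last first.
      by rewrite mulr_ge0// exprn_ge0// ltW.
    rewrite [(gam * rho * _) `^ _]powRM; last 2 first.
    - by rewrite mulr_ge0// ltW.
    - by rewrite exprn_ge0// ltW.
    by rewrite exprMn invfM le_eqVlt; apply/orP; left; apply/eqP; ring.
  apply: le_trans (lee_wpmul2l _ (intB _ (t'0 k.+1))) _; first by rewrite lee_fin.
  rewrite -EFinM lee_fin.
  have tr : t' k.+1 <= rho ^- k.+1 by rewrite ler_piMl// invr_ge0 exprn_ge0// ltW.
  have rk0 : 0 <= rho ^- k.+1 by rewrite invr_ge0 exprn_ge0// ltW.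
  apply: (@le_trans _ _ (b k * (N%:R * (12 * rho ^- k.+1) ^+ N * 1))).
    rewrite ler_wpM2l//; apply: ler_pM => //.
    - by rewrite mulr_ge0// exprn_ge0// mulr_ge0.
    - by rewrite le_min ler01 t'0.
    - have h1 : 0 <= 12 * t' k.+1 by rewrite mulr_ge0.
      have h2 : 0 <= 12 * rho ^- k.+1 by rewrite mulr_ge0.
      by rewrite ler_wpM2l// lerXn2r ?nnegrE// ler_wpM2l.
    - by rewrite ge_min lexx.
  have -> : B * delta ^+ k = M * (gam `^ e)^-1 * (rho ^- N * delta ^+ k).
    by rewrite /B; ring.
  rewrite -far_exponents /b /M /t' powRM; last 2 first.
  - exact: ltW.
  - by rewrite invr_ge0 exprn_ge0// ltW.
  by rewrite exprMn invfM le_eqVlt; apply/orP; left; apply/eqP; ring.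
- move=> n; rewrite big_split/= -!mulr_sumr.
  apply: (@le_trans _ _ (A * (J%:R + (1 - beta)^-1) + B * (1 - delta)^-1)).
    apply: lerD; apply: ler_wpM2l => //; first exact: delayed_geometric_sum_le.
    exact: geometric_sum_le.
  have S0 : 0 <= A * (1 - beta)^-1.
    by rewrite mulr_ge0// invr_ge0 subr_ge0 ltW//; case/andP : hbeta.
  have S1 : 0 <= B * (1 - delta)^-1.
    by rewrite mulr_ge0// invr_ge0 subr_ge0 ltW//; case/andP : hdelta.
  have J0 : 0 <= J%:R :> R by [].
  have h1 := mulr_ge0 S0 J0; have h2 := mulr_ge0 S1 J0; have h3 := mulr_ge0 A0 J0.
  rewrite -natr1; lra.
Qed.

End gagliardo_estimate.

(** * Lower bounds for Lorentz integrals *)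

Section lorentz_tools.
Variable R : realType.
Local Notation mu := (@lebesgue_measure R).

(** The integral of a nonnegative function is a supremum over simple functions below it, hence
    monotone for arbitrary such integrands. It is applied to the Lorentz integrand, whose
    measurability in the level is not established. *)
Lemma nonneg_le_integral d (T : measurableType d) (m : {measure set T -> \bar R})
    (D : set T) (f g : T -> \bar R) :
  (forall x, D x -> (0 <= f x)%E) -> (forall x, D x -> (f x <= g x)%E) ->
  (\int[m]_(x in D) f x <= \int[m]_(x in D) g x)%E.
Proof.
move=> f0 fg.
have g0 x : D x -> (0 <= g x)%E by move=> Dx; exact: le_trans (f0 _ Dx) (fg _ Dx).
rewrite !ge0_integralE//; apply: le_ereal_sup; apply: image_subset => h /= hf x.
apply: (le_trans (hf x)); rewrite !patchE; case: ifPn => //; rewrite inE.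
exact: fg.
Qed.

Lemma sum_indic_sep_le1 (l : seq R) (r x : R) :
  pairwise (fun a b => a + r <= b) l ->
  \sum_(a <- l) \1_(`]a - r, a]%classic) x <= 1 :> R.
Proof.
elim: l => [_|a l IH /= /andP[al hl]]; first by rewrite big_nil.
rewrite big_cons indicE; case: (boolP (x \in _)) => [|_]; last by rewrite add0r IH.
rewrite inE/= in_itv/= => /andP[_ xa]; rewrite big_seq big1 ?addr0// => b /(allP al) ab.
rewrite indicE memNset//= in_itv/= => /andP[bx _]; move: ab bx xa; lra.
Qed.

Lemma integral_indic_itv (a b : R) (x y : bool) : a <= b ->
  (\int[mu]_t (\1_([set` Interval (BSide x a) (BSide y b)]) t)%:E = (b - a)%:E)%E.
Proof.
move=> ab; rewrite integral_indic// setIT.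
apply: (etrans (@lebesgue_measure_itv R (Interval (BSide x a) (BSide y b)))).
rewrite /= lte_fin; case: ltP => h; first by rewrite -EFinD.
by congr (_%:E); move: h ab; lra.
Qed.

(* A geometric ladder of levels: a nonincreasing distribution function [m]
   bounded below at each level contributes the same amount on each step. *)
Lemma integral_ladder_ge (m : R -> \bar R) (L c0 q p m0 : R) (J : nat)
    (mj : nat -> R) : 1 < L -> 0 < c0 -> 0 < p -> 0 < q -> 0 < m0 ->
  (forall l, (0 <= m l)%E) ->
  (forall j, 0 <= mj j) ->
  (forall j, (c0 * L ^+ j) `^ p * mj j = m0) ->
  (forall j l, (j <= J)%N -> 0 < l -> l <= c0 * L ^+ j -> ((mj j)%:E <= m l)%E) ->
  ((J%:R * ((1 - L^-1) * L `^ (- q) * m0 `^ (q / p)))%:E <=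
   \int[mu]_(l in `]0%R, +oo[) ((l `^ q)%:E * m l `^ (q / p) * (l^-1)%:E))%E.
Proof.
move=> L1 c00 p0 q0 m00 m_ge0 mj0 mjE mge.
have L0 : 0 < L by apply: lt_trans L1.
have Lj j : 0 < L ^+ j by rewrite exprn_gt0.
pose lam j := c0 * L ^+ j.
have lam0 j : 0 < lam j by rewrite mulr_gt0.
have lamS j : lam j < lam j.+1 by rewrite ltr_pM2l// exprS ltr_pMl.
(* A lower bound of the integrand on []lam j, lam j.+1]]: the increasing factor is taken at the left
   end, the two nonincreasing ones at the right end. With [j < J], only levels up to [J] occur. *)
pose h j := (lam j) `^ q * (mj j.+1) `^ (q / p) / lam j.+1.
have h0 j : 0 <= h j by rewrite !mulr_ge0 ?powR_ge0// invr_ge0 ltW.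
pose F J' l := \sum_(j < J') h j * \1_(`]lam j, lam j.+1]%classic) l : R.
have F0 J' l : 0 <= F J' l by apply: sumr_ge0 => j _; rewrite mulr_ge0.
have mF J' : measurable_fun [set: R] (F J').
  apply: measurable_sum => j; apply: measurable_funM => //; exact: measurable_indic.
apply: (@le_trans _ _ (\int[mu]_(l in `]0%R, +oo[) (F J l)%:E)%E); last first.
  apply: nonneg_le_integral => l /=; rewrite ?lee_fin// in_itv/= andbT => l0.
  have g0 : (0 <= (l `^ q)%:E * m l `^ (q / p) * (l^-1)%:E)%E.
    apply: mule_ge0; last by rewrite lee_fin invr_ge0 ltW.
    by apply: mule_ge0; [rewrite lee_fin powR_ge0|exact: poweR_ge0].
  have lam_le i j : (i <= j)%N -> lam i <= lam j.
    by move=> ij; rewrite ler_pM2l// ler_eXn2l.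
  have FE j : (j < J)%N -> lam j < l -> l <= lam j.+1 -> F J l = h j.
    move=> jJ l1 l2; rewrite /F (bigD1 (Ordinal jJ))//= indicE mem_set ?mulr1; last first.
      by rewrite /= in_itv/= l1.
    rewrite big1 ?addr0// => i ij; rewrite indicE memNset ?mulr0//= in_itv/= => /andP[i1 i2].
    have [ltij|ltji|eij] := ltngtP i j.
    - by have := lam_le _ _ ltij; move: i1 i2 l1 l2; lra.
    - by have := lam_le _ _ ltji; move: i1 i2 l1 l2; lra.
    - by move/eqP : ij; apply; apply/val_inj.
  have [[j [jJ l1 l2]]|no] := pselect (exists j, [/\ (j < J)%N, lam j < l & l <= lam j.+1]).
    rewrite (FE j)// /h EFinM EFinM; apply: lee_pmul; rewrite ?lee_fin ?mulr_ge0 ?powR_ge0//.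
    - by rewrite invr_ge0 ltW.
    - apply: lee_pmul; rewrite ?lee_fin ?powR_ge0//.
        by apply: ge0_ler_powR; rewrite ?nnegrE ?ltW.
      rewrite -poweR_EFin; apply: gt0_ler_poweR.
      + by rewrite divr_ge0// ltW.
      + by rewrite in_itv/= leey lee_fin mj0.
      + by rewrite in_itv/= leey m_ge0.
      + exact: mge.
    - by rewrite lef_pV2 ?posrE.
  rewrite [F J l](_ : _ = 0) ?g0//; rewrite /F big1// => i _.
  rewrite indicE memNset ?mulr0//= in_itv/= => /andP[i1 i2].
  by apply: no; exists i.
under eq_integral => l _ do rewrite /F -sumEFin.
rewrite ge0_integral_sum//; last 2 first.
- by move=> j; apply/measurable_EFinP; apply: measurable_funM.
- by move=> j l _; rewrite lee_fin mulr_ge0.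
rewrite mulr_natl -[X in (_ *+ X)%:E]card_ord -sumr_const -sumEFin.
apply: lee_sum => j _.
under eq_integral => l _ do rewrite EFinM.
rewrite ge0_integralZl_EFin//; last first.
  by apply/measurable_EFinP; exact: measurable_indic.
rewrite integral_indic// setIidl; last first.
  by move=> l /=; rewrite !in_itv/= andbT => /andP[h1 _]; exact: lt_trans h1.
have mlam : mu `]lam j, lam j.+1] = (lam j.+1 - lam j)%:E.
  apply: (etrans (@lebesgue_measure_itv R `]lam j, lam j.+1])).
  by rewrite /= lte_fin lamS -EFinD.
rewrite [X in (_ <= _ * X)%E]mlam -EFinM lee_fin -(mjE j.+1) -/(lam j.+1).
(* The step has length [lam j.+1 * (1 - L^-1)], which cancels the division in [h j]; the rest is
   [L ^ (- q)] times [m0 ^ (q / p)]. *)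
rewrite powRM ?powR_ge0// -powRrM mulrC [p * (q / p)]mulrC divfK ?gt_eqF//.
rewrite /h.
have lamE : lam j = lam j.+1 / L.
  by rewrite /lam exprSr mulrA mulfK// gt_eqF.
have LV : L^-1 `^ q = L `^ (- q) by rewrite -powR_inv1 ?(ltW L0)// -powRrM mulN1r.
rewrite lamE powRM ?invr_ge0 ?(ltW L0) ?(ltW (lam0 _))// LV.
rewrite le_eqVlt; apply/orP; left; apply/eqP; field.
by rewrite !gt_eqF.
Qed.

End lorentz_tools.

(** * Lower bound for the Lorentz quasi-norm *)

Section lorentz_estimate.
Variables (R : realType) (n : nat) (w rho s p : R).
Hypothesis rho_bnd : 0 < rho < 2^-1.
Hypothesis w_eq : w = 1 \/ w = 2^-1.
Hypothesis s_bnd : 0 < s < 1.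
Hypothesis p_gt1 : 1 < p.
Hypothesis w_rho : w `^ (p - 1) = rho `^ (s * p - 1).
Local Notation mu := (@lebesgue_measure R).
Local Notation N := n.+1.
Local Notation psi := (cantor_bump w rho).
Local Notation u J := (tensor (fun _ : 'I_N => psi J)).
Local Notation a := (N%:R / p + s).

Let rho0 : 0 < rho. Proof. by case/andP : rho_bnd. Qed.
Let rho2 : rho < 2^-1. Proof. by case/andP : rho_bnd. Qed.
Let rho1 : rho < 1. Proof. by apply: lt_trans rho2 _; lra. Qed.
Let w0 : 0 < w. Proof. by case: w_eq => ->; lra. Qed.
Let a0 : 0 < a.
Proof. by case/andP : s_bnd => s0 _; rewrite ltr_wpDl// divr_ge0// ltW// (lt_trans _ p_gt1). Qed.

(* The pairs [(x, y)] for which [u x - u y] is at least [w ^+ j]: the first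
   coordinates lie on either side of an interval of generation [j], the other
   ones lie in the region where the bump is 1. *)
Let pairs0 j (z : R * R) : R := \sum_(b <- cantor_left w rho j)
  \1_(`](b - 1 - rho ^+ j), (b - 1)]%classic) z.1 *
  \1_(`[(b - 1 + rho ^+ j), (b - 1 + rho ^+ j + rho ^+ j)]%classic) z.2.

(** A first point in [[1/4, 3/4]] and a distance at most [rho ^+ j / 4] keep both points on the
    plateau [[0, 1]]. *)
Let pairs1 j (z : R * R) : R :=
  \1_(band (rho ^+ j / 4)) z * \1_(`[4^-1, 3 / 4]%classic) z.1.

Let pairs j (i : 'I_N) := if i == ord0 then pairs0 j else pairs1 j.

Let rj0 j : 0 < rho ^+ j. Proof. by rewrite exprn_gt0. Qed.

Let measurable_pairs0 j : measurable_fun [set: R * R] (pairs0 j).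
Proof.
apply: measurable_sum => b; apply: measurable_funM.
  by apply: (measurableT_comp _ measurable_fst); exact: measurable_indic.
by apply: (measurableT_comp _ measurable_snd); exact: measurable_indic.
Qed.

Let measurable_pairs1 j : measurable_fun [set: R * R] (pairs1 j).
Proof.
apply: measurable_funM; first exact: measurable_indic (measurable_band _).
by apply: (measurableT_comp _ measurable_fst); exact: measurable_indic.
Qed.

Let pairs0_ge0 j z : 0 <= pairs0 j z.
Proof. by apply: sumr_ge0 => b _; rewrite mulr_ge0. Qed.

Let pairs1_ge0 j z : 0 <= pairs1 j z.
Proof. by rewrite mulr_ge0. Qed.

Let measurable_pairs j i : measurable_fun [set: R * R] (pairs j i).
Proof.
by rewrite /pairs; case: ifP => _; [exact: measurable_pairs0|exact: measurable_pairs1].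
Qed.

Let pairs_ge0 j i z : 0 <= pairs j i z.
Proof. by rewrite /pairs; case: ifP => _; [exact: pairs0_ge0|exact: pairs1_ge0]. Qed.

Let indic_le1 T (A : set T) x : \1_A x <= 1 :> R.
Proof. by rewrite indicE lern1 leq_b1. Qed.

(** The strips for different endpoints are disjoint by [cantor_left_sep], so at most one summand is
    nonzero. Hence a product of such factors can sit below an indicator. *)
Let pairs0_le1 j z : pairs0 j z <= 1.
Proof.
apply: (@le_trans _ _ (\sum_(b <- cantor_left w rho j)
    \1_(`]b - rho ^+ j, b]%classic) (z.1 + 1))).
  apply: ler_sum => b _; rewrite -[leRHS]mulr1; apply: ler_pM => //.
  rewrite !indicE ler_nat; case: (boolP (z.1 \in _)) => //.
  rewrite inE/= in_itv/= => /andP[h1 h2]; rewrite mem_set//= in_itv/=.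
  by apply/andP; split; lra.
by apply: sum_indic_sep_le1; exact: cantor_left_sep.
Qed.

Let pairs1_le1 j z : pairs1 j z <= 1.
Proof. by rewrite -[leRHS]mulr1; apply: ler_pM. Qed.

Let pairs_le1 j i z : pairs j i z <= 1.
Proof. by rewrite /pairs; case: ifP => _; [exact: pairs0_le1|exact: pairs1_le1]. Qed.

Let integral_pairs0 j :
  (\int[mu]_x \int[mu]_y (pairs0 j (x, y))%:E = ((w ^+ j)^-1 * rho ^+ j ^+ 2)%:E)%E.
Proof.
set I1 := fun b : R => `](b - 1 - rho ^+ j), (b - 1)]%classic.
set I2 := fun b : R => `[(b - 1 + rho ^+ j), (b - 1 + rho ^+ j + rho ^+ j)]%classic.
have mI1 b : measurable_fun [set: R] (\1_(I1 b) : R -> R).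
  by apply: measurable_indic; exact: measurable_itv.
have mI2 b : measurable_fun [set: R] (\1_(I2 b) : R -> R).
  by apply: measurable_indic; exact: measurable_itv.
have inner x : (\int[mu]_y (pairs0 j (x, y))%:E =
    \sum_(b <- cantor_left w rho j) (rho ^+ j * \1_(I1 b) x)%:E)%E.
  rewrite /pairs0/=; under eq_integral => y _ do rewrite -sumEFin.
  rewrite (ge0_integral_sum mu measurableT); first last.
  - by move=> b y _; rewrite lee_fin mulr_ge0.
  - by move=> b; apply/measurable_EFinP; apply: measurable_funM => //; exact: mI2.
  apply: eq_bigr => b _; under eq_integral => y _ do rewrite EFinM.
  rewrite ge0_integralZl_EFin//; last by apply/measurable_EFinP; exact: mI2.
  rewrite integral_indic_itv; last by rewrite lerDl ltW.
  by rewrite -EFinM mulrC; congr (_ * _)%:E; ring.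
under eq_integral => x _ do rewrite inner.
rewrite (ge0_integral_sum mu measurableT); first last.
- by move=> b x _; rewrite lee_fin mulr_ge0// ltW.
- by move=> b; apply/measurable_EFinP; apply: measurable_funM => //; exact: mI1.
rewrite (eq_bigr (fun=> (rho ^+ j * rho ^+ j)%:E)); last first.
  move=> b _; under eq_integral => x _ do rewrite EFinM.
  rewrite ge0_integralZl_EFin ?ltW//; last by apply/measurable_EFinP; exact: mI1.
  rewrite integral_indic_itv; last by rewrite lerBlDr lerDl ltW.
  by rewrite -EFinM; congr (_ * _)%:E; ring.
rewrite sumEFin big_const_seq count_predT iter_addr_0 -[X in X%:E]mulr_natl.
congr (_%:E); rewrite expr2; congr (_ * _).
apply: (mulIf (lt0r_neq0 (exprn_gt0 j w0))).
by rewrite (cantor_left_size rho w_eq) mulVf// gt_eqF// exprn_gt0.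
Qed.

Let integral_pairs1 j :
  (\int[mu]_x \int[mu]_y (pairs1 j (x, y))%:E = (rho ^+ j / 4)%:E)%E.
Proof.
have mI : measurable_fun [set: R] (fun x => (\1_(`[4^-1, 3 / 4]%classic) x)%:E : \bar R).
  by apply/measurable_EFinP; exact: measurable_indic.
have := @integral_bandl R (rho ^+ j / 4) (fun x => (\1_(`[4^-1, 3 / 4]%classic) x)%:E).
rewrite integral_indic_itv; last by lra.
move=> /(_ _ mI _)/= H; rewrite H//.
- by rewrite -EFinM; congr (_%:E); field.
- by rewrite divr_ge0// ltW.
Qed.

Let integral_pairs j :
  (\int[lebesgue_rV2 R N]_z (\prod_(i < N) pairs j i (z.1 ord0 i, z.2 ord0 i))%:E =
   ((w ^+ j)^-1 * rho ^+ j ^+ 2 * (rho ^+ j / 4) ^+ n)%:E)%E.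
Proof.
under eq_integral => z _ do rewrite -prodEFin.
rewrite (@integral_rV2_prod _ _ (fun i z => (pairs j i z)%:E)); last 2 first.
- move=> i; apply/measurable_EFinP; exact: measurable_pairs.
- by move=> i z; rewrite lee_fin pairs_ge0.
rewrite big_ord_recl /pairs eqxx integral_pairs0 /=.
by under eq_bigr do rewrite integral_pairs1; rewrite prodEFin prodr_const card_ord.
Qed.

(** The product of the [pairs] is supported in the superlevel set. There the numerator is at least
    [w ^+ j]; the first coordinates differ by at most [3 * rho ^+ j] and the [n] others by at most
    [rho ^+ j], hence the distance [(3 + N) * rho ^+ j]. *)
Let level J j l : (j <= J)%N -> 0 < l ->
  l <= w ^+ j / (((3 + N%:R) * rho ^+ j) `^ a) ->
  (((w ^+ j)^-1 * rho ^+ j ^+ 2 * (rho ^+ j / 4) ^+ n)%:E <=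
   lebesgue_rV2 R N [set z | (l <= `|diff_quotient a (u J) z|)%R])%E.
Proof.
move=> jJ l0 lle; rewrite -integral_pairs.
set S := [set z | (l <= _)%R].
have mS : measurable S.
  rewrite /S -[X in measurable X]setTI.
  apply: (@measurable_fun_le _ _ R setT (cst l) (fun z => `|diff_quotient a (u J) z|)) => //.
  apply: measurableT_comp => //; rewrite /diff_quotient; apply: measurable_funM.
    apply: measurable_tensor_diff => k; exact: smooth_upto_bump.
  under eq_fun do rewrite -powRN.
  apply: (measurableT_comp (measurable_powR (- a))); exact: measurable_enorm_diff.
rewrite -[S in leRHS]setIT -integral_indic//.
apply: ge0_le_integral => //.
- by move=> z _; rewrite lee_fin; apply: prodr_ge0.
- apply/measurable_EFinP; apply: measurable_prod => i _.
  exact: (measurableT_comp (measurable_pairs j i) (measurable_rV2_coord i)).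
- by apply/measurable_EFinP; exact: measurable_indic.
move=> z _; rewrite lee_fin.
have [zS|zS] := boolP (z \in S).
  by rewrite indicE zS; apply: prodr_ile1 => i _; rewrite pairs_ge0 pairs_le1.
have [pz|[i pi0]] : (forall i, pairs j i (z.1 ord0 i, z.2 ord0 i) != 0) \/
    (exists i, pairs j i (z.1 ord0 i, z.2 ord0 i) == 0).
- have [|h] := pselect (exists i, pairs j i (z.1 ord0 i, z.2 ord0 i) == 0); first by right.
  by left => i; apply/negP => hi; apply: h; exists i.
- exfalso; move/negP : zS; apply; rewrite inE /S/=; apply: (le_trans lle).
  have [b bl] : exists2 b, b \in cantor_left w rho j &
      \1_(`](b - 1 - rho ^+ j), (b - 1)]%classic) (z.1 ord0 ord0) *
      \1_(`[(b - 1 + rho ^+ j), (b - 1 + rho ^+ j + rho ^+ j)]%classic) (z.2 ord0 ord0)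
      != 0 :> R.
    apply: contrapT => no; have /eqP := pz ord0; apply.
    rewrite /pairs eqxx /pairs0 big_seq big1// => b bl.
    by apply/eqP/negPn/negP => h; apply: no; exists b.
  rewrite mulf_eq0 negb_or !indicE !pnatr_eq0 !eqb0 !negbK.
  move=> /andP[/set_mem/= + /set_mem/=]; rewrite !in_itv/=.
  move=> /andP[x1 x2] /andP[y1 y2].
  have /andP[b0 b1] := cantor_left_bnd rho_bnd bl.
  have r1 : rho ^+ j <= 1 by rewrite exprn_ile1// ltW.
  have far (i : 'I_n) : let k := lift ord0 i in
      `|z.1 ord0 k - z.2 ord0 k| <= rho ^+ j / 4 /\ 4^-1 <= z.1 ord0 k <= 3 / 4.
    have := pz (lift ord0 i); rewrite /pairs /= /pairs1 mulf_eq0 negb_or.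
    rewrite !indicE !pnatr_eq0 !eqb0 !negbK => /andP[/set_mem h1 /set_mem/= h2].
    by split => //; move: h2; rewrite in_itv.
  have rj := rj0 j.
  have far1 (i : 'I_n) : 0 <= z.1 ord0 (lift ord0 i) <= 1.
    by have [_] := far i; lra.
  have far2 (i : 'I_n) : 0 <= z.2 ord0 (lift ord0 i) <= 1.
    by have [] := far i; rewrite ler_norml; lra.
  rewrite /diff_quotient normrM normfV [X in _ <= _ * X^-1]ger0_norm ?powR_ge0//.
  apply: ler_pM; rewrite ?exprn_ge0 ?invr_ge0 ?powR_ge0 ?(ltW w0)//.
    rewrite /tensor !big_ord_recl.
    rewrite [X in psi J (z.1 _ _) * X]big1 => [|i _]; last exact: bump_in.
    rewrite [X in psi J (z.2 _ _) * X]big1 => [|i _]; last exact: bump_in.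
    rewrite !mulr1 distrC !bump_left//; [|lra|lra].
    apply: le_trans (ler_norm _).
    have h1 : cantor_fun w rho J (z.1 ord0 ord0 + 1) <= cantor_fun w rho J b.
      by apply: cantor_homo => //; lra.
    have h2 : cantor_fun w rho J (b + rho ^+ j) <= cantor_fun w rho J (z.2 ord0 ord0 + 1).
      by apply: cantor_homo => //; lra.
    by have := cantor_left_incr rho_bnd w_eq jJ bl; lra.
  (* The first coordinates are at least [rho ^+ j] apart, so the quotient is not the default value
     of the diagonal. *)
  have d0 : 0 < enorm (z.1 - z.2).
    apply: lt_le_trans (coord_le_enorm _ ord0); rewrite !mxE.
    by rewrite distrC; apply: lt_le_trans (ler_norm _); lra.
  rewrite lef_pV2 ?posrE ?powR_gt0//; last by rewrite mulr_gt0.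
  apply: ge0_ler_powR; rewrite ?nnegrE ?(ltW a0) ?(ltW d0)//.
    by rewrite mulr_ge0// ltW.
  apply: le_trans (enorm_le_sum _) _; rewrite big_ord_recl mulrDl; apply: lerD.
    by rewrite !mxE ler_norml; apply/andP; split; lra.
  apply: (@le_trans _ _ (\sum_(i < n) rho ^+ j)).
    by apply: ler_sum => i _; rewrite !mxE; have [] := far i; lra.
  by rewrite sumr_const card_ord -[leLHS]mulr_natl ler_wpM2r ?ler_nat// ltW.
by rewrite (bigD1 i)//= (eqP pi0) mul0r.
Qed.

Let pow_mono (x y : R) : x < y -> rho `^ y < rho `^ x.
Proof.
move=> xy; rewrite -(subrK x y) -(powR_add rho0) -[ltRHS]mul1r ltr_pM2r ?powR_gt0//.
have rho01 : 0 < rho < 1 by rewrite rho0.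
have yx0 : 0 < y - x by rewrite subr_gt0.
by case/andP : (powR_lt1 rho01 yx0).
Qed.

(** Otherwise [w_rho] would give [rho ^ (s p - 1) <= rho ^ (a (p - 1))], while
    [a (p - 1) = N (1 - 1/p) + s p - s] exceeds [s p - 1] because [s < 1]. *)
Let ladder_ratio_gt1 : 1 < w / rho `^ a.
Proof.
rewrite ltr_pdivlMr ?powR_gt0// mul1r ltNge; apply/negP => h.
have : w `^ (p - 1) <= (rho `^ a) `^ (p - 1).
  apply: ge0_ler_powR; rewrite ?nnegrE ?powR_ge0 ?(ltW w0)//.
  by rewrite subr_ge0 ltW.
rewrite w_rho -powRrM leNgt pow_mono// mulrDl.
have -> : N%:R / p * (p - 1) = N%:R * (1 - p^-1).
  by field; rewrite gt_eqF// (lt_trans _ p_gt1).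
have h1 : 0 <= N%:R * (1 - p^-1) :> R.
  by rewrite mulr_ge0// subr_ge0 invf_le1// ?(ltW p_gt1)// (lt_trans _ p_gt1).
by case/andP : s_bnd; move: h1; lra.
Qed.

Lemma lorentz_integral_ge (q : R) : 0 < q -> exists2 c : R, 0 < c & forall J,
  ((c * J%:R)%:E <= \int[mu]_(l in `]0%R, +oo[)
    ((l `^ q)%:E *
     lebesgue_rV2 R N [set z | (l <= `|diff_quotient a (u J) z|)%R] `^ (q / p) *
     (l^-1)%:E))%E.
Proof.
move=> q0; have p0 : 0 < p by apply: lt_trans p_gt1.
pose L := w / rho `^ a; pose c0 := ((3 + N%:R) `^ a)^-1 : R.
have c00 : 0 < c0 by rewrite invr_gt0 powR_gt0.
pose m0 := c0 `^ p * 4^-1 ^+ n.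
have m00 : 0 < m0 by rewrite mulr_gt0 ?powR_gt0// exprn_gt0.
have L0 : 0 < L by rewrite divr_gt0 ?powR_gt0.
exists ((1 - L^-1) * L `^ (- q) * m0 `^ (q / p)) => [|J].
  by rewrite !mulr_gt0 ?powR_gt0// subr_gt0 invf_lt1.
rewrite mulrC; apply: (@integral_ladder_ge R
  (fun l => lebesgue_rV2 R N [set z | (l <= `|diff_quotient a (u J) z|)%R])
  L c0 q p m0 J (fun j => (w ^+ j)^-1 * rho ^+ j ^+ 2 * (rho ^+ j / 4) ^+ n)) => //.
- by move=> j; rewrite !mulr_ge0 ?invr_ge0 ?exprn_ge0// ?divr_ge0 ?exprn_ge0// ltW.
(* Scale invariance: [w ^ (j (p - 1))] becomes [rho ^ (j (s p - 1))], and the remaining exponent of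
   [rho] is [j (n + 2 - a p) = j (1 - s p)], so everything cancels. *)
- move=> j; rewrite powRM ?(ltW c00) ?exprn_ge0 ?(ltW L0)// /m0 -mulrA; congr (_ * _).
  rewrite /L expr_div_n powRM ?invr_ge0 ?exprn_ge0 ?(ltW w0) ?powR_ge0//.
  rewrite [(rho ^+ j / 4) ^+ n]exprMn.
  rewrite powR_exprn// [(w ^+ j)^-1](_ : _ = w `^ (- j%:R)); last first.
    by rewrite powRN powR_mulrn// ltW.
  have -> : w `^ (j%:R * p) * ((rho `^ a ^+ j)^-1) `^ p *
      (w `^ (- j%:R) * rho ^+ j ^+ 2 * (rho ^+ j ^+ n * 4^-1 ^+ n)) =
      (w `^ (j%:R * p) * w `^ (- j%:R)) * ((rho `^ a ^+ j)^-1) `^ p *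
      (rho ^+ j ^+ 2 * rho ^+ j ^+ n) * 4^-1 ^+ n by ring.
  rewrite -powRD; last by apply/implyP => _; rewrite gt_eqF.
  rewrite (_ : j%:R * p + - j%:R = (p - 1) * j%:R); last by ring.
  rewrite powRrM w_rho -[X in _ = X]mul1r; congr (_ * _).
  rewrite -!exprM -!(powR_mulrn _ (ltW rho0)) -(powR_mulrn j (powR_ge0 _ _)).
  rewrite -!powRN -!powRrM !(powR_add rho0) -[RHS](powRr0 rho); congr (_ `^ _).
  by rewrite !natrM -[N%:R]natr1; field; rewrite gt_eqF.
- move=> j l jJ l0 lle; apply: (level jJ l0); apply: (le_trans lle).
  rewrite powRM ?exprn_ge0 ?(ltW rho0)// invfM mulrCA -/c0 ler_wpM2l ?(ltW c00)//.
  rewrite /L expr_div_n -(powR_mulrn j (powR_ge0 _ _)) -powRrM powR_exprn// [a * _]mulrC.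
  exact: lexx.
Qed.

End lorentz_estimate.

(** * Choice of parameters and comparison of growth rates *)

Section cantor_parameters.
Variable R : realType.

(** If [s1 p1 = 1] both exponents are harmless with [w = 1], and 1/4 is just a ratio below 1/2.
    Otherwise [w = 1/2] determines [rho]. *)
Lemma exists_cantor_parameters (s1 p1 : R) :
  s1 < 1 -> 1 < p1 -> 1 <= s1 * p1 ->
  exists w rho : R, [/\ w = 1 \/ w = 2^-1, 0 < rho < 2^-1 &
    w `^ (p1 - 1) = rho `^ (s1 * p1 - 1)].
Proof.
move=> s1_lt1 p1_gt1; rewrite le_eqVlt => /predU1P[e|h].
  exists 1, 4^-1; split; [by left|lra|].
  by rewrite -e subrr powRr0 powR1.
have d0 : 0 < s1 * p1 - 1 by rewrite subr_gt0.
pose t := (p1 - 1) / (s1 * p1 - 1).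
have t1 : 1 < t.
  rewrite ltr_pdivlMr// mul1r ltrD2r gtr_pMl//; exact: lt_trans p1_gt1.
have h2 : (0 : R) < 2^-1 by lra.
exists 2^-1, (2^-1 `^ t); split; [by right| |].
  rewrite powR_gt0//= -(subrK 1 t) powRD; last by apply/implyP => _; rewrite gt_eqF.
  rewrite powRr1 ?(ltW h2)// gtr_pMl//.
  have h3 : 0 < (2^-1 : R) < 1 by lra.
  have t0 : 0 < t - 1 by rewrite subr_gt0.
  by case/andP : (powR_lt1 h3 t0).
by rewrite -powRrM /t divfK// gt_eqF.
Qed.

(* On the line of exponents [(s, 1/p)] joining [(s1, 1/p1)] to [(1, 1)], the
   ratio [(s p - 1) / (p - 1)] is constant. *)
Lemma cantor_parameters_interpolation (s1 p1 theta s p w rho : R) :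
  0 < p1 -> 0 < theta -> 0 < p ->
  s = theta * s1 + (1 - theta) -> 1 / p = theta / p1 + (1 - theta) ->
  w `^ (p1 - 1) = rho `^ (s1 * p1 - 1) -> w `^ (p - 1) = rho `^ (s * p - 1).
Proof.
move=> p10 theta0 p0 sE pE e.
have p1E : p * (theta / p1 + (1 - theta)) = 1 by rewrite -pE mulrC divfK// gt_eqF.
have p1n : p1 != 0 by rewrite gt_eqF.
have -> : p - 1 = (p1 - 1) * (p * theta / p1).
  rewrite -[X in p - X]p1E; by field.
have -> : s * p - 1 = (s1 * p1 - 1) * (p * theta / p1).
  rewrite sE -[X in _ - X]p1E; by field.
by rewrite !powRrM e.
Qed.

(** If [x > y], then [J.+1 <= 2 * J] would give [J ^ (x - y) <= B * 2 ^ y] for all [J > 0], against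
    the Archimedean property. *)
Lemma powR_growth_le (x y B : R) : 0 < y ->
  (forall J, (0 < J)%N -> J%:R `^ x <= B * J.+1%:R `^ y) -> x <= y.
Proof.
move=> y0 h; rewrite leNgt; apply/negP => yx.
have B0 : 0 < B * 2 `^ y.
  have := h 1%N isT; rewrite (congr1 (@^~ x) (powR1 R))//; exact: lt_le_trans.
have Bpos : 0 < B by move: B0; rewrite pmulr_lgt0// powR_gt0.
have d0 : 0 < x - y by rewrite subr_gt0.
have bound J : (0 < J)%N -> J%:R <= (B * 2 `^ y) `^ (x - y)^-1.
  move=> J0; have J0' : (0 : R) < J%:R by rewrite ltr0n.
  rewrite [leLHS](_ : _ = (J%:R `^ (x - y)) `^ (x - y)^-1); last first.
    by rewrite -powRrM divff ?gt_eqF// powRr1// ltW.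
  apply: ge0_ler_powR; rewrite ?nnegrE ?powR_ge0 ?invr_ge0 ?(ltW B0) ?(ltW d0)//.
  rewrite powRB; last by apply/implyP => _; rewrite gt_eqF.
  rewrite ler_pdivrMr ?powR_gt0// -mulrA -powRM ?(ltW J0')//.
  apply: (le_trans (h J J0)); rewrite ler_wpM2l ?(ltW Bpos)//.
  apply: ge0_ler_powR; rewrite ?nnegrE ?mulr_ge0 ?(ltW y0) ?(ltW J0')//.
  by rewrite -natrM ler_nat mul2n -addnn -addn1 leq_add2l.
have := archi_boundP (powR_ge0 (B * 2 `^ y) (x - y)^-1).
case: (Num.Def.archi_bound _) => [|J]; first by rewrite ltNge powR_ge0.
by rewrite ltNge bound.
Qed.

End cantor_parameters.

Theorem lemma5p1 (R : realType) (N : nat) (hN : (1 <= N)%N)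
    (s1 p1 theta : R) (hs1 : 0 < s1 < 1) (hp1 : 1 < p1) (hsp : 1 <= s1 * p1)
    (htheta : 0 < theta < 1)
    (s p : R) (hs : 0 < s < 1) (hp : 1 < p)
    (sE : s = theta * s1 + (1 - theta))
    (pE : 1 / p = theta / p1 + (1 - theta))
    (q : \bar R) (hq : (1 <= q)%E) :
  (exists C : R, forall u : 'rV[R]_N -> R, Cc_infty u ->
    (lorentz (lebesgue_rV2 R N) p q (diff_quotient (N%:R / p + s) u) <=
     C%:E * gagliardo s1 p1 u `^ theta *
     'N[lebesgue_rV R N]_1[(fun x => (enorm (gradient u x))%:E)] `^ (1 - theta))%E) ->
  ((p1 / theta)%:E <= q)%E.
Proof.
move=> [C hC].
case: q hq hC => [q hq hC|_ _|//]; last exact: leey.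
have q1 : 1 <= q by rewrite -lee_fin.
have q0 : 0 < q by apply: lt_le_trans q1.
have p0 : 0 < p by apply: lt_trans hp.
have p10 : 0 < p1 by apply: lt_trans hp1.
have [theta0 theta1] := andP htheta.
have s1_lt1 : s1 < 1 by case/andP : hs1.
have [w [rho [w_eq rho_bnd e1]]] := exists_cantor_parameters s1_lt1 hp1 hsp.
have e := cantor_parameters_interpolation p10 theta0 p0 sE pE e1.
case: N hN hC => // n _ hC.
have [K K0 hK] := gagliardo_integral_le n.+1 rho_bnd w_eq hs1 hp1 e1.
have [c c0 hc] := lorentz_integral_ge n rho_bnd w_eq hs hp e q0.
pose A : R := n.+1%:R * 3 ^+ n.+1.
have A0 : 0 <= A by rewrite mulr_ge0// exprn_ge0.
(* [C] may be negative, hence the absolute value. The divisor is the constant in front of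
   [J ^ (1/q)] in the Lorentz lower bound. *)
pose B : R := `|C| * (K `^ p1^-1 `^ theta) * A `^ (1 - theta) / (p * c) `^ q^-1.
have pc0 : 0 < p * c by rewrite mulr_gt0.
suff H : q^-1 <= theta / p1.
  rewrite lee_fin -[leLHS]invrK -[leRHS]invrK lef_pV2 ?posrE ?invr_gt0 ?divr_gt0//.
  by rewrite invf_div.
apply: (@powR_growth_le _ _ _ B); first by rewrite divr_gt0.
move=> J J0.
set u := tensor (fun _ : 'I_n.+1 => cantor_bump w rho J).
have su k : smooth_upto k (cantor_bump w rho J) by exact: smooth_upto_bump.
have bu x : 0 <= cantor_bump w rho J x <= 1 by exact: bump_bnd.
have iu := integral_bump rho_bnd w_eq J.
have idu := integral_derive_bump rho_bnd w_eq J.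
have hu : Cc_infty u.
  apply: (@Cc_infty_tensor _ _ _ (-1) 2); first by move=> k i; exact: su.
  by move=> i t; exact: bump_out.
have grad := gradient_norm_le n.+1 su bu iu idu.
have mono (x y : \bar R) (r : R) : 0 <= r -> (0 <= x)%E -> (x <= y)%E ->
    (x `^ r <= y `^ r)%E.
  move=> r0 x0 xy; apply: gt0_ler_poweR => //; rewrite in_itv/= leey ?x0//.
  by rewrite (le_trans x0 xy).
have gagl : (gagliardo s1 p1 u <= ((K * J.+1%:R) `^ p1^-1)%:E)%E.
  rewrite -poweR_EFin; apply: mono (hK J); first by rewrite invr_ge0 ltW.
  by apply: integral_ge0 => z _; rewrite lee_fin divr_ge0 ?powR_ge0.
have low : (((p * (c * J%:R)) `^ q^-1)%:E <=
    lorentz (lebesgue_rV2 R n.+1) p q%:E (diff_quotient (n.+1%:R / p + s) u))%E.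
  rewrite -poweR_EFin /lorentz EFinM; apply: mono; first by rewrite invr_ge0 ltW.
    by rewrite mule_ge0// lee_fin ?(ltW p0)// mulr_ge0// ltW.
  by apply: lee_wpmul2l (hc J); rewrite lee_fin ltW.
have := le_trans low (hC u hu).
have gagl0 : (0 <= gagliardo s1 p1 u)%E by exact: poweR_ge0.
set X := (C%:E * _ * _)%E => low2.
have : (X <= (`|C| * ((K * J.+1%:R) `^ p1^-1) `^ theta * A `^ (1 - theta))%:E)%E.
  apply: (@le_trans _ _ (`|C|%:E * gagliardo s1 p1 u `^ theta *
     'N[lebesgue_rV R n.+1]_1[(fun x => (enorm (gradient u x))%:E)] `^ (1 - theta))%E).
    rewrite /X; apply: lee_wpmul2r; first exact: poweR_ge0.
    by apply: lee_wpmul2r; [exact: poweR_ge0|rewrite lee_fin ler_norm].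
  rewrite !EFinM -!poweR_EFin; apply: lee_pmul.
  - by rewrite mule_ge0 ?poweR_ge0// lee_fin.
  - exact: poweR_ge0.
  - apply: lee_wpmul2l; first by rewrite lee_fin.
    by apply: mono; [exact: ltW|exact: poweR_ge0|rewrite poweR_EFin].
  - by apply: mono; [rewrite subr_ge0 ltW|exact: Lnorm_ge0|exact: grad].
move=> /(le_trans low2); rewrite lee_fin mulrA => low3.
rewrite /B mulrAC ler_pdivlMr ?powR_gt0// mulrC -powRM ?(ltW pc0)//.
apply: (le_trans low3).
rewrite [(K * _) `^ _]powRM ?(ltW K0)// [(_ * _) `^ theta]powRM ?powR_ge0//.
rewrite -[J.+1%:R `^ p1^-1 `^ theta]powRrM [p1^-1 * theta]mulrC.
by rewrite le_eqVlt; apply/orP; left; apply/eqP; ring.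
Qed.
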